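(* The vector $x^{A}$ is a $1/2$-approximate solution for the chance-constrained binary knapsack problem (CKP), that is, $x^A$ is feasible for the CKP and $\sum_{j\in N}c_jx^A_j\ge \frac12 z_{OPT}$. Moreover, $x^{A}$ can be obtained in $O(n^3\log n)$ time.
   Context: Let $N=\{1,\dots,n\}$ be a set of items. Each $j\in N$ has a profit $c_j>0$ and a random weight $\tilde a_j\sim\mathcal N(a_j,\sigma_j^2)$ with $a_j>0$, $\sigma_j\ge 0$ (if $\sigma_j=0$ the weight is the constant $a_j$); the weights are mutually independent. The capacity is $b>0$, the threshold is $\rho\in[0.5,1)$, and $\Phi^{-1}$ is the inverse of the standard normal cumulative distribution function. Standing assumptions: $\sum_{j\in N}a_j+\Phi^{-1}(\rho)\sqrt{\sum_{j\in N}\sigma_j^2}>b$, and $a_j+\Phi^{-1}(\rho)\sigma_j\le b$ for each $j\in N$. CKP: $z_{OPT}=\max\{\sum_{j\in N}c_jx_j: x\in\{0,1\}^n,\ \mathbb{P}\{\sum_{j\in N}\tilde a_jx_j\le b\}\ge\rho\}$; the chance constraint is equivalent to $\sum_{j\in N}a_jx_j+\Phi^{-1}(\rho)\sqrt{\sum_{j\in N}\sigma_j^2x_j^2}\le b$. Non-convex relaxation: $\max\{\sum_{j\in N}c_jx_j: x\in[0,1]^n,\ g(x)\le b\}$, where $g(x)=\sum_{j\in N}a_jx_j+\Phi^{-1}(\rho)\sqrt{\sum_{j\in N}\sigma_j^2x_j}$. Orderings $\tau(\delta)$: let $\bar N=\{j\in N:\sigma_j=0\}$. For $j\in N$ and $\delta\ge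 0$ let $a_j(0)=a_j$, $a_j(\delta)=a_j+\frac{\Phi^{-1}(\rho)}{2\sqrt\delta}\sigma_j^2$ for $\delta>0$, and $p_j(\delta)=c_j/a_j(\delta)$. For $\delta>0$, $\tau(\delta)$ is the sequence of all elements of $N$ sorted in descending order of $p_j(\delta)$. For $\delta=0$, $\tau(0)$ lists first the elements of $\bar N$ in descending order of $p_j(0)$, then those of $N\setminus\bar N$ in descending order of $p_j(0)$. Ties are resolved in descending order of $\sigma_j^2/c_j$, and remaining ties in ascending order of index. Greedy points $x(\delta)$: for $\delta\ge 0$ write $\tau(\delta)=(\tau_1,\dots,\tau_n)$ and let $t'=\min\{k\in N:\sum_{j=1}^k a_{\tau_j}+\Phi^{-1}(\rho)\sqrt{\sum_{j=1}^k\sigma_{\tau_j}^2}\ge b\}$. Let $\theta^\star$ be the smaller of the two solutions $\theta\in\mathbb R$ of $\Phi^{-1}(\rho)^2\big(\sum_{j=1}^{t'-1}\sigma_{\tau_j}^2+\sigma_{\tau_{t'}}^2\theta\big)=\big(b-\sum_{j=1}^{t'-1}a_{\tau_j}-a_{\tau_{t'}}\theta\big)^2$; then $0<\theta^\star\le1$. Define $x_{\tau_j}(\delta)=1$ for $j<t'$, $x_{\tau_{t'}}(\delta)=\theta^\star$, and $x_{\tau_j}(\delta)=0$ for $j>t'$. Candidate set $\Delta^\star$: for a pair $\{k,l\}\subseteq N$, a reverse point is a $q>0$ with $p_k(q)=p_l(q)$ such that the relative order of $k$ and $l$ differs between $\tau(q-\alpha)$ and $\tau(q)$ for all sufficiently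 small $\alpha>0$. Let $Q$ be the set of reverse points of all pairs, let $\gamma$ satisfy $0<\gamma<\min Q$ (any positive real if $Q=\emptyset$), and let $\Delta=\{0,\gamma\}\cup Q$. Let $\delta_U=\max\{\sum_{j\in N}\sigma_j^2x_j: x\in[0,1]^n,\ g(x)\le b\}$, $\delta_L=\min\{\sum_{j\in N}\sigma_j^2x_j: x\in[0,1]^n,\ g(x)\ge b\}$, and $\Delta^\star=\{q\in\Delta:\delta_L\le q\le\delta_U\}\cup\{\max\{\delta_L,\gamma\}\}$. Definition of $x^A$: let $x^\star=x(q)$ for a $q\in\Delta^\star$ maximizing $\sum_{j\in N}c_jx_j(q)$ over $\Delta^\star$; this is the optimal solution of the non-convex relaxation obtained by the paper's algorithm, which enumerates $\Delta^\star$. It has at most one fractional coordinate; let $t\in N$ be the index of this coordinate (if there is none, $t$ is an index with $x^\star_t=0$, so that in all cases $0\le x^\star_t<1$). Let $x^D_j=\lfloor x^\star_j\rfloor$ for all $j\in N$; let $x^U_t=1$ and $x^U_j=0$ for $j\in N\setminus\{t\}$. Then $x^A=x^D$ if $\sum_{j\in N}c_jx^U_j\le\sum_{j\in N}c_jx^D_j$, and $x^A=x^U$ otherwise. Running time counts elementary operations on real numbers (arithmetic operations, comparisons, square roots), with $\Phi^{-1}(\rho)$ given. *)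

(* Defs.v *)
From mathcomp Require Import all_boot all_order all_algebra.
From mathcomp Require Import all_classical all_reals all_analysis.

Set Implicit Arguments.
Unset Strict Implicit.
Unset Printing Implicit Defensive.

Import Order.TTheory GRing.Theory Num.Theory.
Import numFieldNormedType.Exports.

Local Open Scope classical_set_scope.
Local Open Scope ring_scope.

(* The value 0 is returned when the extremum is not attained. *)
Definition max_of (R : realType) (A : set R) : R := xget 0 (A `&` ubound A).
Definition min_of (R : realType) (A : set R) : R := xget 0 (A `&` lbound A).

Definition std_normal_cdf (R : realType) (x : R) : \bar R :=
  normal_prob (0 : R) 1 `]-oo, x].

Definition std_normal_quantile (R : realType) (p : R) : R :=
  xget 0 [set x | std_normal_cdf x = p%:E].

Record instance (R : realType) (n : nat) := Instance {
  profit : 'I_n -> R;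
  mean : 'I_n -> R;
  stdev : 'I_n -> R;
  capacity : R;
  level : R }.

Definition quantile (R : realType) (n : nat) (K : instance R n) : R :=
  std_normal_quantile (level K).

Definition standing_assumptions (R : realType) (n : nat) (K : instance R n)
    : Prop :=
  [/\ forall j, [/\ 0 < profit K j, 0 < mean K j & 0 <= stdev K j],
      0 < capacity K,
      2^-1 <= level K < 1,
      capacity K < \sum_j mean K j
                   + quantile K * Num.sqrt (\sum_j stdev K j ^+ 2)
    & forall j, mean K j + quantile K * stdev K j <= capacity K].

Definition objective (R : realType) (n : nat) (K : instance R n)
    (x : 'I_n -> R) : R := \sum_j profit K j * x j.

(* The case s = 0 is treated apart because [normal_prob m 0] is, by a library
   convention, the uniform distribution on [0, 1]. *)
Definition has_normal_law d (T : measurableType d) (R : realType)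
    (P : probability T R) (X : {RV P >-> R}) (m s : R) : Prop :=
  forall B : set R, measurable B ->
    distribution P X B = if s == 0 then \d_m B else normal_prob m s B.

Definition mutually_independent d (T : measurableType d) (R : realType)
    (P : probability T R) (n : nat) (X : 'I_n -> {RV P >-> R}) : Prop :=
  forall (J : {set 'I_n}) (B : 'I_n -> set R),
    (forall j, measurable (B j)) ->
    P [set w | forall j, j \in J -> B j (X j w)]
    = (\prod_(j in J) P (X j @^-1` B j))%E.

Definition random_weights d (T : measurableType d) (R : realType)
    (P : probability T R) (n : nat) (K : instance R n)
    (W : 'I_n -> {RV P >-> R}) : Prop :=
  (forall j, has_normal_law (W j) (mean K j) (stdev K j)) /\
  mutually_independent W.

Definition ckp_feasible d (T : measurableType d) (R : realType)
    (P : probability T R) (n : nat) (K : instance R n)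
    (W : 'I_n -> {RV P >-> R}) (x : 'I_n -> R) : Prop :=
  (forall j, x j = 0 \/ x j = 1) /\
  ((level K)%:E <= P [set w | (\sum_j W j w * x j <= capacity K)%R])%E.

Definition ckp_opt d (T : measurableType d) (R : realType)
    (P : probability T R) (n : nat) (K : instance R n)
    (W : 'I_n -> {RV P >-> R}) : R :=
  max_of [set objective K x | x in ckp_feasible K W].

Definition approximate_solution d (T : measurableType d) (R : realType)
    (P : probability T R) (n : nat) (K : instance R n)
    (W : 'I_n -> {RV P >-> R}) (alpha : R) (x : 'I_n -> R) : Prop :=
  ckp_feasible K W x /\ alpha * ckp_opt K W <= objective K x.

Definition unit_box (R : realType) (n : nat) (x : 'I_n -> R) : Prop :=
  forall j, 0 <= x j <= 1.

Definition relaxed_load (R : realType) (n : nat) (K : instance R n)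
    (x : 'I_n -> R) : R :=
  \sum_j mean K j * x j
  + quantile K * Num.sqrt (\sum_j stdev K j ^+ 2 * x j).

Definition variance_of (R : realType) (n : nat) (K : instance R n)
    (x : 'I_n -> R) : R := \sum_j stdev K j ^+ 2 * x j.

Definition adjusted_mean (R : realType) (n : nat) (K : instance R n)
    (delta : R) (j : 'I_n) : R :=
  if delta == 0 then mean K j
  else mean K j + quantile K / (2 * Num.sqrt delta) * stdev K j ^+ 2.

Definition density (R : realType) (n : nat) (K : instance R n)
    (delta : R) (j : 'I_n) : R := profit K j / adjusted_mean K delta j.

Definition precedes (R : realType) (n : nat) (K : instance R n)
    (delta : R) (k l : 'I_n) : bool :=
  let p := density K delta in
  let r j := stdev K j ^+ 2 / profit K j in
  if (delta == 0) && ((stdev K k == 0) != (stdev K l == 0))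
  then stdev K k == 0
  else (p l < p k) || (p k == p l) &&
       ((r l < r k) || (r k == r l) && (k <= l)%N).

Definition tau (R : realType) (n : nat) (K : instance R n) (delta : R)
    : seq 'I_n := sort (precedes K delta) (enum 'I_n).

Definition sequence_load (R : realType) (n : nat) (K : instance R n)
    (s : seq 'I_n) : R :=
  \sum_(j <- s) mean K j
  + quantile K * Num.sqrt (\sum_(j <- s) stdev K j ^+ 2).

(* The number of items of [tau K delta] before the critical one: in 1-based
   notation this is t' - 1, with t' the least k in 1..n such that the first k
   items have load at least the capacity. *)
Definition n_full (R : realType) (n : nat) (K : instance R n) (delta : R)
    : nat :=
  find (fun k => capacity K <= sequence_load K (take k (tau K delta)))
       (iota 1 n).

Definition theta_star (R : realType) (n : nat) (K : instance R n)
    (s : seq 'I_n) (t : 'I_n) : R :=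
  min_of [set theta : R |
    quantile K ^+ 2 * (\sum_(j <- s) stdev K j ^+ 2 + stdev K t ^+ 2 * theta)
    = (capacity K - \sum_(j <- s) mean K j - mean K t * theta) ^+ 2].

Definition greedy_point (R : realType) (n : nat) (K : instance R n)
    (delta : R) (j : 'I_n) : R :=
  let s := tau K delta in
  let m := n_full K delta in
  if (index j s < m)%N then 1
  else if index j s == m then theta_star K (take m s) j
  else 0.

Definition comes_before (R : realType) (n : nat) (K : instance R n)
    (delta : R) (k l : 'I_n) : bool :=
  (index k (tau K delta) < index l (tau K delta))%N.

Definition reverse_point (R : realType) (n : nat) (K : instance R n)
    (k l : 'I_n) (q : R) : Prop :=
  [/\ 0 < q, density K q k = density K q l
    & \forall alpha \near 0^'+,
        comes_before K (q - alpha) k l != comes_before K q k l].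

Definition reverse_points (R : realType) (n : nat) (K : instance R n)
    : set R := [set q | exists k l : 'I_n, k != l /\ reverse_point K k l q].

Definition below_reverse_points (R : realType) (n : nat) (K : instance R n)
    (gamma : R) : Prop :=
  0 < gamma /\ forall q, reverse_points K q -> gamma < q.

Definition delta_U (R : realType) (n : nat) (K : instance R n) : R :=
  max_of [set variance_of K x | x in
           [set x | unit_box x /\ relaxed_load K x <= capacity K]].

Definition delta_L (R : realType) (n : nat) (K : instance R n) : R :=
  min_of [set variance_of K x | x in
           [set x | unit_box x /\ capacity K <= relaxed_load K x]].

Definition candidates (R : realType) (n : nat) (K : instance R n)
    (gamma : R) : set R :=
  [set q | ([set 0; gamma] `|` reverse_points K) q
           /\ delta_L K <= q <= delta_U K]
  `|` [set Num.max (delta_L K) gamma].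

Definition best_candidate (R : realType) (n : nat) (K : instance R n)
    (gamma q : R) : Prop :=
  candidates K gamma q /\
  forall q', candidates K gamma q' ->
    objective K (greedy_point K q') <= objective K (greedy_point K q).

Definition fractional_index (R : realType) (n : nat) (x : 'I_n -> R)
    (t : 'I_n) : Prop :=
  0 < x t < 1 \/ ((forall j, ~~ (0 < x j < 1)) /\ x t = 0).

Definition round_down (R : realType) (n : nat) (x : 'I_n -> R) (j : 'I_n)
    : R := (Num.floor (x j))%:~R.

Definition unit_point (R : realType) (n : nat) (t j : 'I_n) : R :=
  (j == t)%:R.

Definition better_rounding (R : realType) (n : nat) (K : instance R n)
    (x : 'I_n -> R) (t : 'I_n) : 'I_n -> R :=
  if objective K (unit_point R t) <= objective K (round_down x)
  then round_down x else unit_point R t.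

(* The point depends on the choice of gamma, of a maximizer q, and of t when
   no coordinate is fractional; [is_xA K x] holds for the outcome of every
   admissible choice. *)
Definition is_xA (R : realType) (n : nat) (K : instance R n)
    (x : 'I_n -> R) : Prop :=
  exists gamma q t,
    [/\ below_reverse_points K gamma, best_candidate K gamma q,
        fractional_index (greedy_point K q) t
      & x = better_rounding K (greedy_point K q) t].

(* A real RAM, presented as a structured language over named scalars and
   arrays of two sorts: natural numbers (loop counters and indices) and reals.
   The sorts only interact through array indices and tests: there is no
   rounding of a real to an integer and no multiplication of indices.
   Every node of an expression and every executed command costs one unit, so
   the running time bounds the number of operations on real numbers, and also
   accounts for index arithmetic, memory accesses and control.
   Following the conventions for the field operations of [R], x / 0 = 0, and
   the square root of a negative number is 0. *)
Inductive iexp : Type :=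
| INum of nat
| IVar of nat
| IGet of nat & iexp
| IAdd of iexp & iexp
| ISub of iexp & iexp.

Inductive rexp : Type :=
| RZero
| ROne
| RVar of nat
| RGet of nat & iexp
| RAdd of rexp & rexp
| RSub of rexp & rexp
| RMul of rexp & rexp
| RDiv of rexp & rexp
| RSqrt of rexp.

Inductive bexp : Type :=
| BILe of iexp & iexp
| BRLe of rexp & rexp
| BNot of bexp
| BAnd of bexp & bexp.

Inductive cmd : Type :=
| CSkip
| CISet of nat & iexp
| CRSet of nat & rexp
| CIPut of nat & iexp & iexp
| CRPut of nat & iexp & rexp
| CSeq of cmd & cmd
| CIf of bexp & cmd & cmd
| CWhile of bexp & cmd.

Record state (R : realType) := State {
  ivar : nat -> nat;
  rvar : nat -> R;
  iarr : nat -> nat -> nat;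
  rarr : nat -> nat -> R }.

Definition update (A : Type) (f : nat -> A) (k : nat) (v : A) : nat -> A :=
  fun i => if i == k then v else f i.

Definition set_ivar (R : realType) (s : state R) (v : nat) (m : nat) :=
  State (update (ivar s) v m) (rvar s) (iarr s) (rarr s).
Definition set_rvar (R : realType) (s : state R) (v : nat) (r : R) :=
  State (ivar s) (update (rvar s) v r) (iarr s) (rarr s).
Definition set_iarr (R : realType) (s : state R) (a i : nat) (m : nat) :=
  State (ivar s) (rvar s) (update (iarr s) a (update (iarr s a) i m)) (rarr s).
Definition set_rarr (R : realType) (s : state R) (a i : nat) (r : R) :=
  State (ivar s) (rvar s) (iarr s) (update (rarr s) a (update (rarr s a) i r)).

Fixpoint ieval (R : realType) (s : state R) (e : iexp) : nat :=
  match e with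
  | INum m => m
  | IVar v => ivar s v
  | IGet a e => iarr s a (ieval s e)
  | IAdd e f => (ieval s e + ieval s f)%N
  | ISub e f => (ieval s e - ieval s f)%N
  end.

Fixpoint reval (R : realType) (s : state R) (e : rexp) : R :=
  match e with
  | RZero => 0
  | ROne => 1
  | RVar v => rvar s v
  | RGet a e => rarr s a (ieval s e)
  | RAdd e f => reval s e + reval s f
  | RSub e f => reval s e - reval s f
  | RMul e f => reval s e * reval s f
  | RDiv e f => reval s e / reval s f
  | RSqrt e => Num.sqrt (reval s e)
  end.

Fixpoint beval (R : realType) (s : state R) (e : bexp) : bool :=
  match e with
  | BILe e f => (ieval s e <= ieval s f)%N
  | BRLe e f => reval s e <= reval s f
  | BNot e => ~~ beval s e
  | BAnd e f => beval s e && beval s f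
  end.

Fixpoint icost (e : iexp) : nat :=
  match e with
  | INum _ | IVar _ => 1
  | IGet _ e => (icost e).+1
  | IAdd e f | ISub e f => (icost e + icost f).+1
  end.

Fixpoint rcost (e : rexp) : nat :=
  match e with
  | RZero | ROne | RVar _ => 1
  | RGet _ e => (icost e).+1
  | RAdd e f | RSub e f | RMul e f | RDiv e f => (rcost e + rcost f).+1
  | RSqrt e => (rcost e).+1
  end.

Fixpoint bcost (e : bexp) : nat :=
  match e with
  | BILe e f => (icost e + icost f).+1
  | BRLe e f => (rcost e + rcost f).+1
  | BNot e => (bcost e).+1
  | BAnd e f => (bcost e + bcost f).+1
  end.

(* [exec c s s' t]: started in [s], [c] terminates in [s'] after [t] steps. *)
Inductive exec (R : realType) : cmd -> state R -> state R -> nat -> Prop :=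
| ExecSkip s : exec CSkip s s 1
| ExecISet s v e :
    exec (CISet v e) s (set_ivar s v (ieval s e)) (icost e).+1
| ExecRSet s v e :
    exec (CRSet v e) s (set_rvar s v (reval s e)) (rcost e).+1
| ExecIPut s a i e :
    exec (CIPut a i e) s (set_iarr s a (ieval s i) (ieval s e))
      (icost i + icost e).+1
| ExecRPut s a i e :
    exec (CRPut a i e) s (set_rarr s a (ieval s i) (reval s e))
      (icost i + rcost e).+1
| ExecSeq c1 c2 s1 s2 s3 t1 t2 :
    exec c1 s1 s2 t1 -> exec c2 s2 s3 t2 ->
    exec (CSeq c1 c2) s1 s3 (t1 + t2).+1
| ExecIfTrue b c1 c2 s s' t :
    beval s b -> exec c1 s s' t ->
    exec (CIf b c1 c2) s s' (bcost b + t).+1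
| ExecIfFalse b c1 c2 s s' t :
    ~~ beval s b -> exec c2 s s' t ->
    exec (CIf b c1 c2) s s' (bcost b + t).+1
| ExecWhileTrue b c s1 s2 s3 t1 t2 :
    beval s1 b -> exec c s1 s2 t1 -> exec (CWhile b c) s2 s3 t2 ->
    exec (CWhile b c) s1 s3 (bcost b + t1 + t2).+1
| ExecWhileFalse b c s :
    ~~ beval s b -> exec (CWhile b c) s s (bcost b).+1.

Definition array_of (R : realType) (n : nat) (x : 'I_n -> R) (i : nat) : R :=
  if insub i is Some j then x j else 0.

(* Input: index scalar 0 holds n; real scalars 0 and 1 hold the capacity and
   the given normal quantile; real arrays 0, 1, 2 hold the profits, means and
   standard deviations. All other memory cells are 0. *)
Definition input_state (R : realType) (n : nat) (K : instance R n) : state R :=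
  State (nth 0%N [:: n])
        (nth 0 [:: capacity K; quantile K])
        (fun _ _ => 0%N)
        (nth (fun _ => 0)
           [:: array_of (profit K); array_of (mean K); array_of (stdev K)]).

(* The output is read in the first n cells of real array 3. *)
Definition output (R : realType) (n : nat) (s : state R) (j : 'I_n) : R :=
  rarr s 3 j.

(* Main.v *)
Require Import Defs.
From HB Require Import structures.
From mathcomp Require Import all_boot all_order all_algebra.
From mathcomp Require Import all_classical all_reals all_analysis.
From mathcomp Require Import measurable_realfun zify ring lra.

Set Implicit Arguments.
Unset Strict Implicit.
Unset Printing Implicit Defensive.

Import Order.TTheory GRing.Theory Num.Theory.
Import numFieldNormedType.Exports.

Local Open Scope classical_set_scope.
Local Open Scope ring_scope.

(** The approximation bound and the algorithm rest on one comparison between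
    an arbitrary point x of the unit box whose relaxed load is at most b and a
    greedy point. Let delta be the variance of x. The square root is concave,
    so its tangent at delta bounds it from above, with equality at x. If the
    square root in the load is replaced by this tangent, item j weighs
    a_j(delta), and tau(delta) orders the items by profit per weight. The
    greedy point x(delta) fills the capacity exactly for the true load, so it
    uses at least as much of the linearized capacity as x does, and the
    exchange argument of the fractional knapsack problem shows that x(delta)
    is worth at least as much as x ([le_objective_greedy]).

    As x(delta) fills the capacity, its own variance lies between delta_L and
    delta_U, and a second use of the comparison bounds x by a greedy point
    whose parameter lies in this interval. The order tau(delta) changes only
    where the densities of two items cross, and these points are reverse
    points, so the candidates reach all greedy points of the interval
    ([exists_candidate]); hence the best candidate is worth at least as much
    as every feasible point ([best_candidate_max]). Only its critical
    coordinate can be fractional, so its value is at most the sum of the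
    values of the two roundings ([better_rounding_half]). The link with the
    chance constraint is that a sum of independent normal weights is normal
    ([law_sum]), so that for 0/1 vectors the constraint becomes a bound on the
    relaxed load ([ckp_feasibleE]).

    The program does not sort. For an item k, whether k is critical at delta,
    and the greedy point if it is, depend only on the set of items before k,
    and this set changes only when delta passes a crossing of k with another
    item. So it suffices to test, for every k, the parameter 1 and the
    crossings of k and their halves ([test_points_cover]): O(n^2) pairs,
    each of which takes O(n) operations to sum over the items before k. Every
    parameter produces a true greedy point, so there is no need to know which
    crossings are reverse points. The best parameter found need not lie
    between delta_L and delta_U; but the variance delta' of its greedy point
    does, and x(delta') is worth at least as much. The program therefore
    rounds x(delta'), and never computes delta_L, delta_U or gamma
    ([exists_best_candidate]). This takes O(n^3) operations, which is within
    the required bound because the standing assumptions force n >= 2, so that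
    ln n is bounded away from 0. *)

(** * Normal laws and their convolution *)

Section Affine.
Context {R : realType}.
Local Notation mu := (@lebesgue_measure R).

Let affine (s c : R) (x : measurableTypeR R) : measurableTypeR R := s * x + c.

Let measurable_affine s c : measurable_fun setT (affine s c).
Proof.
by apply: measurable_funD => //; apply: measurable_funM.
Qed.

(** A measure on the line is determined by its values on half-open intervals,
    and the preimage of such an interval is again one. *)
Lemma lebesgue_measure_affine (s c : R) (A : set R) : 0 < s -> measurable A ->
  (s%:E * mu ((fun x => s * x + c)%R @^-1` A) = mu A)%E.
Proof.
move=> s0 mA; have s_ge0 := ltW s0.
pose nu : {measure set (measurableTypeR R) -> \bar R} :=
  mscale (NngNum s_ge0) (pushforward mu (affine s c)).
apply/esym/(@lebesgue_measure_unique R (nu (measurable_affine s c))) => //.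
move=> X /ocitvP [->|[[a b] /= ab ->]]; first by rewrite !measure0.
rewrite /nu /= /mscale /= /pushforward.
have -> : affine s c @^-1` `]a, b] = `](a - c) / s, (b - c) / s]%classic.
  apply/seteqP; split => x /=;
    by rewrite !in_itv /= ltr_pdivrMr// ler_pdivlMr// ltrBlDr lerBrDr (mulrC x).
rewrite !lebesgue_measure_itv/= !lte_fin ltr_pM2r ?invr_gt0// ltrD2r.
case: ifP => _; last by rewrite mule0.
by rewrite -!EFinB -EFinM; congr EFin; field; rewrite gt_eqF.
Qed.

Lemma ge0_integral_affine (s c : R) (g : R -> \bar R) : 0 < s ->
  measurable_fun setT g -> (forall x, 0 <= g x)%E ->
  (s%:E * \int[mu]_x g (s * x + c)%R = \int[mu]_x g x)%E.
Proof.
move=> s0 mg g0; have s_ge0 := ltW s0.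
have mf := measurable_affine s c.
pose nu : {measure set (measurableTypeR R) -> \bar R} :=
  pushforward mu (affine s c).
transitivity (\int[mscale (NngNum s_ge0) (nu mf)]_x g x)%E.
  by rewrite ge0_integral_mscale// ge0_integral_pushforward.
apply: eq_measure_integral => A mA _; exact: lebesgue_measure_affine.
Qed.

End Affine.

Section Normal.
Context {R : realType}.
Local Notation mu := (@lebesgue_measure R).
Implicit Types (m s : R).

Lemma normal_pdf_affine m s r c x : 0 < r -> s != 0 ->
  r * normal_pdf (r * m + c) (r * s) (r * x + c) = normal_pdf m s x.
Proof.
move=> r0 s0; have r_neq0 : r != 0 by rewrite gt_eqF.
rewrite !normal_pdfE ?mulf_neq0// mulrA; congr (_ * _).
  rewrite /normal_peak exprMn -mulrA -mulrnAr sqrtrM ?sqr_ge0//.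
  by rewrite sqrtr_sqr gtr0_norm// invfM mulVKf.
rewrite /normal_fun; congr expR.
rewrite -[s ^+ 2 *+ 2]mulr_natr -[(r * s) ^+ 2 *+ 2]mulr_natr.
by field; rewrite s0 r_neq0.
Qed.

Lemma normal_prob_affine m s r c (A : set R) : 0 < r -> s != 0 -> measurable A ->
  normal_prob m s ((fun x => r * x + c) @^-1` A)
  = normal_prob (r * m + c) (r * s) A.
Proof.
move=> r0 s0 mA; rewrite /normal_prob [LHS]integral_mkcond [RHS]integral_mkcond.
set f := (fun x => (normal_pdf (r * m + c) (r * s) x)%:E) \_ A.
have mf : measurable_fun setT f.
  apply/measurable_restrict => //; rewrite setTI.
  by apply/measurable_EFinP/measurable_funTS; exact: measurable_normal_pdf.
have f0 x : (0 <= f x)%E.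
  by rewrite /f patchE; case: ifP => // _; rewrite lee_fin normal_pdf_ge0.
rewrite -(ge0_integral_affine c r0 mf f0) -ge0_integralZl_EFin ?ltW//; last first.
  by apply: measurableT_comp => //; apply: measurable_funD => //; apply: measurable_funM.
apply: eq_integral => x _; rewrite /f !patchE.
have -> : (x \in (fun x => r * x + c) @^-1` A) = (r * x + c \in A) by [].
by case: ifP => _; rewrite ?mule0// -EFinM normal_pdf_affine.
Qed.

Lemma normal_prob_shift m s c (A : set R) : s != 0 -> measurable A ->
  normal_prob m s ((fun x => x + c) @^-1` A) = normal_prob (m + c) s A.
Proof.
move=> s0 mA; rewrite -[m in RHS]mul1r -[s in RHS]mul1r -normal_prob_affine//.
by congr normal_prob; apply/seteqP; split => x /=; rewrite mul1r.
Qed.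

(** The density and the Radon-Nikodym derivative have the same integral over
    every measurable set, so they agree almost everywhere. *)
Lemma ge0_integral_normal_prob m s (f : R -> \bar R) :
  measurable_fun setT f -> (forall x, 0 <= f x)%E ->
  (\int[normal_prob m s]_x f x = \int[mu]_x (f x * (normal_pdf m s x)%:E))%E.
Proof.
move=> mf f0.
have dom := @normal_prob_dominates R m s.
rewrite -(Radon_Nikodym_SigmaFinite.change_of_variables dom)//.
apply: ae_eq_integral => //.
- apply: emeasurable_funM => //; apply: (measurable_int mu).
  exact: Radon_Nikodym_SigmaFinite.f_integrable.
- apply: emeasurable_funM => //=; apply/measurable_EFinP.
  exact: measurable_normal_pdf.
- apply: ae_eqe_mul2l; apply: integral_ae_eq => //=.
  + exact: Radon_Nikodym_SigmaFinite.f_integrable.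
  + by apply/measurable_EFinP; exact: measurable_normal_pdf.
  + by move=> E _ mE; rewrite -Radon_Nikodym_SigmaFinite.f_integral.
Qed.

Lemma complete_square (u w p q : R) : p != 0 -> q != 0 -> p + q != 0 ->
  u ^+ 2 / (p *+ 2) + (w - u) ^+ 2 / (q *+ 2) =
  w ^+ 2 / ((p + q) *+ 2)
  + (u - w * p / (p + q)) ^+ 2 / ((p * q / (p + q)) *+ 2).
Proof. by move=> p0 q0 pq0; field; rewrite p0 q0 pq0. Qed.

(** Completing the square in x factors the joint density of X and X + Y at
    (x, z) into a function of z and a normal density in x, whose integral
    is 1. *)
Lemma normal_pdf_convolution m1 s1 m2 s2 (x z : R) : s1 != 0 -> s2 != 0 ->
  let s := Num.sqrt (s1 ^+ 2 + s2 ^+ 2) in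
  normal_pdf m1 s1 x * normal_pdf m2 s2 (z - x) =
  normal_pdf (m1 + m2) s z *
  normal_pdf (m1 + (z - m1 - m2) * s1 ^+ 2 / s ^+ 2) (s1 * s2 / s) x.
Proof.
move=> s10 s20 /=.
have s1p : 0 < s1 ^+ 2 by rewrite exprn_even_gt0.
have s2p : 0 < s2 ^+ 2 by rewrite exprn_even_gt0.
have sp : 0 < s1 ^+ 2 + s2 ^+ 2 by rewrite addr_gt0.
have : Num.sqrt (s1 ^+ 2 + s2 ^+ 2) != 0 by rewrite gt_eqF// sqrtr_gt0.
have : Num.sqrt (s1 ^+ 2 + s2 ^+ 2) ^+ 2 = s1 ^+ 2 + s2 ^+ 2.
  by rewrite sqr_sqrtr// ltW.
move: (Num.sqrt _) => s s2E s0.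
rewrite !normal_pdfE// ?mulf_neq0 ?invr_eq0//.
rewrite mulrACA [RHS]mulrACA; congr (_ * _).
  rewrite /normal_peak -!invfM -!sqrtrM; last 2 first.
  - by rewrite mulrn_wge0// mulr_ge0 ?pi_ge0// sqr_ge0.
  - by rewrite mulrn_wge0// mulr_ge0 ?pi_ge0// sqr_ge0.
  congr (Num.sqrt _)^-1; move: (pi : R) => p.
  by field.
rewrite /normal_fun -!expRD; congr expR.
rewrite !mulNr -!opprD; congr (- _).
have -> : z - x - m2 = (z - m1 - m2) - (x - m1) by ring.
have -> : (s1 * s2 / s) ^+ 2 = s1 ^+ 2 * s2 ^+ 2 / (s1 ^+ 2 + s2 ^+ 2).
  by rewrite exprMn exprVn exprMn s2E.
rewrite s2E complete_square ?gt_eqF//.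
by congr (_ ^+ 2 / _ + _ ^+ 2 / _); ring.
Qed.

End Normal.

Section Gaussian.
Context {R : realType}.
Local Notation mu := (@lebesgue_measure R).
Implicit Types (m s : R).

(** With the point mass for s = 0, deterministic weights need no separate
    treatment in sums. *)
Definition gaussian m s : probability (measurableTypeR R) R :=
  if s == 0 then (@dirac _ (measurableTypeR R) m R : probability (measurableTypeR R) R)
  else (normal_prob m s : probability (measurableTypeR R) R).

Lemma gaussianE m s (A : set R) :
  gaussian m s A = if s == 0 then \d_m A else normal_prob m s A.
Proof. by rewrite /gaussian; case: ifP. Qed.

Lemma gaussian_shift m s c (A : set R) : measurable A ->
  gaussian m s ((fun x => x + c) @^-1` A) = gaussian (m + c) s A.
Proof.
move=> mA; rewrite !gaussianE; have [s0|s0] := eqVneq s 0; last exact: normal_prob_shift.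
by rewrite /dirac !indicE.
Qed.

Local Open Scope ereal_scope.

Lemma measurable_shift (P : probability (measurableTypeR R) R) (A : set R) :
  measurable A ->
  measurable_fun setT (fun x : R => P ((fun y => (y + x)%R) @^-1` A)).
Proof.
move=> mA.
pose C : set (measurableTypeR R * measurableTypeR R) :=
  (fun p => (p.2 + p.1)%R : measurableTypeR R) @^-1` A.
have mC : measurable C.
  rewrite -[C]setTI; have : measurable_fun setT
    (fun p : measurableTypeR R * measurableTypeR R => (p.2 + p.1)%R : measurableTypeR R).
    exact: measurable_funD measurable_snd measurable_fst.
  by apply.
have -> : (fun x : R => P ((fun y => (y + x)%R) @^-1` A)) = P \o xsection C.
  apply/funext => x /=; congr (P _); apply/seteqP.
  by split => y; rewrite /xsection /= inE.
exact: measurable_fun_xsection.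
Qed.

(** After the translation z = x + y, Fubini's theorem allows x to be
    integrated out first, by [normal_pdf_convolution]. *)
Lemma normal_prob_convolution m1 s1 m2 s2 (A : set R) :
  s1 != 0%R -> s2 != 0%R -> measurable A ->
  \int[normal_prob m1 s1]_x normal_prob m2 s2 ((fun y => (y + x)%R) @^-1` A)
  = normal_prob (m1 + m2) (Num.sqrt (s1 ^+ 2 + s2 ^+ 2)) A.
Proof.
move=> s10 s20 mA; set sd := Num.sqrt _.
have mpdf m s : measurable_fun setT (@normal_pdf R m s) by exact: measurable_normal_pdf.
pose f (p : measurableTypeR R * measurableTypeR R) : \bar R :=
  (\1_A p.2 * (normal_pdf m1 s1 p.1 * normal_pdf m2 s2 (p.2 - p.1)))%:E.
have mf : measurable_fun setT f.
  apply/measurable_EFinP; apply: measurable_funM.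
    by apply: measurableT_comp => //; exact: measurable_indic.
  apply: measurable_funM; first exact: (measurableT_comp (mpdf m1 s1) measurable_fst).
  exact: (measurableT_comp (mpdf m2 s2) (measurable_funB measurable_snd measurable_fst)).
have f0 p : 0 <= f p.
  by rewrite lee_fin mulr_ge0 ?mulr_ge0 ?normal_pdf_ge0// indicE; case: (_ \in _).
transitivity (\int[mu]_x \int[mu]_z f (x, z)).
  rewrite ge0_integral_normal_prob; last 2 first.
  - exact: measurable_shift.
  - by move=> x; exact: measure_ge0.
  apply: eq_integral => x _.
  rewrite normal_prob_shift//.
  transitivity (\int[mu]_z ((normal_pdf m1 s1 x)%:E
      * (\1_A z * normal_pdf (m2 + x) s2 z)%:E)).
    rewrite ge0_integralZl_EFin ?normal_pdf_ge0//; last 2 first.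
    - by move=> z _; rewrite lee_fin mulr_ge0 ?normal_pdf_ge0// indicE; case: (_ \in _).
    - apply/measurable_EFinP/measurable_funM; [exact: measurable_indic|exact: mpdf].
    rewrite muleC /normal_prob [X in _ * X]integral_mkcond; congr (_ * _).
    apply: eq_integral => z _; rewrite patchE indicE.
    by case: ifP => _; rewrite ?mul1r ?mul0r.
  apply: eq_integral => z _; rewrite /f -EFinM; congr EFin => /=.
  rewrite mulrCA; congr (_ * (_ * _))%R.
  by rewrite !normal_pdfE// /normal_fun opprD addrA addrAC.
rewrite (@fubini_tonelli _ _ _ _ R mu mu f mf f0) /=.
rewrite /normal_prob [RHS]integral_mkcond; apply: eq_integral => z _.
rewrite patchE.
pose mx := (m1 + (z - m1 - m2) * s1 ^+ 2 / sd ^+ 2)%R.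
transitivity (\int[mu]_x ((\1_A z * normal_pdf (m1 + m2) sd z)%:E
  * (normal_pdf mx (s1 * s2 / sd) x)%:E)).
  by apply: eq_integral => x _; rewrite /f -EFinM /= normal_pdf_convolution// mulrA.
rewrite ge0_integralZl_EFin//; last 3 first.
- by move=> x _; rewrite lee_fin normal_pdf_ge0.
- by apply/measurable_EFinP; exact: mpdf.
- by rewrite mulr_ge0 ?normal_pdf_ge0// indicE; case: (_ \in _).
rewrite integral_normal_pdf mule1 indicE; case: ifP => _; by rewrite ?mul1r ?mul0r.
Qed.

Lemma gaussian_convolution m1 s1 m2 s2 (A : set R) :
  (0 <= s1)%R -> (0 <= s2)%R -> measurable A ->
  (gaussian m1 s1 \x gaussian m2 s2) [set p | A (p.1 + p.2)%R]
  = gaussian (m1 + m2) (Num.sqrt (s1 ^+ 2 + s2 ^+ 2)) A.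
Proof.
move=> s10 s20 mA; rewrite /product_measure1 /comp.
transitivity (\int[gaussian m1 s1]_x gaussian m2 s2 ((fun y => (y + x)%R) @^-1` A)).
  apply: eq_integral => x _; congr (gaussian m2 s2 _).
  by apply/seteqP; split => y; rewrite /xsection /= inE /= addrC.
have [->|s1n0] := eqVneq s1 0%R.
  have -> : gaussian m1 0 = @dirac _ (measurableTypeR R) m1 R :> (set _ -> _).
    by rewrite /gaussian eqxx.
  rewrite integral_dirac//=; last exact: measurable_shift.
  rewrite diracT mul1e gaussian_shift// addrC.
  by rewrite expr0n add0r sqrtr_sqr ger0_norm.
have [->|s2n0] := eqVneq s2 0%R.
  rewrite expr0n addr0 sqrtr_sqr ger0_norm//.
  rewrite -gaussian_shift//.
  transitivity (\int[gaussian m1 s1]_x (\1_((fun x => (x + m2)%R) @^-1` A) x)%:E).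
    apply: eq_integral => x _; rewrite gaussianE eqxx /dirac; congr EFin.
    rewrite !indicE; congr (nat_of_bool _)%:R.
    by apply/idP/idP; rewrite !inE /= addrC.
  rewrite integral_indic ?setIT//.
  rewrite -[X in measurable X]setTI; have : measurable_fun setT
    (fun x : measurableTypeR R => (x + m2)%R : measurableTypeR R).
    by apply: measurable_funD.
  by apply.
have s0 : Num.sqrt (s1 ^+ 2 + s2 ^+ 2) != 0%R.
  by rewrite gt_eqF// sqrtr_gt0 addr_gt0// exprn_even_gt0.
rewrite gaussianE (negPf s0) -normal_prob_convolution//.
by rewrite /gaussian (negPf s1n0) (negPf s2n0).
Qed.

End Gaussian.

(** * Sums of independent normal weights *)

Section IndependentSum.
Context d (T : measurableType d) (R : realType) (P : probability T R).
Variables (n : nat) (m s : 'I_n -> R) (W : 'I_n -> {RV P >-> R}).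
Hypothesis s_ge0 : forall j, 0 <= s j.
Hypothesis W_law : forall j, has_normal_law (W j) (m j) (s j).
Hypothesis W_indep : mutually_independent W.
Local Open Scope ereal_scope.

Let law j (A : set R) : measurable A -> P (W j @^-1` A) = gaussian (m j) (s j) A.
Proof. by move=> mA; rewrite gaussianE -(W_law j mA). Qed.

Lemma measurable_sum_RV (J : {set 'I_n}) :
  measurable_fun setT (fun w => (\sum_(j in J) W j w)%R).
Proof.
have -> : (fun w => \sum_(j in J) W j w)%R
    = (fun w => \sum_(j <- enum J) W j w)%R.
  by apply/funext => w; rewrite big_enum.
by apply: measurable_sum => j.
Qed.

Lemma measurable_RV_preimage j (A : set R) : measurable A ->
  measurable (W j @^-1` A).
Proof. by move=> mA; rewrite -[X in measurable X]setTI; exact: measurable_funP. Qed.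

(** The conditions B_j on the weights outside J make the claim inductive:
    when i is added to J, the set for the i-th weight is one more condition
    in the induction hypothesis. *)
Lemma joint_law_sum (J : {set 'I_n}) (A : set R) (B : 'I_n -> set R) :
  measurable A -> (forall j, measurable (B j)) ->
  P [set w | A (\sum_(j in J) W j w)%R /\ forall j, j \notin J -> B j (W j w)]
  = gaussian (\sum_(j in J) m j) (Num.sqrt (\sum_(j in J) s j ^+ 2)) A
    * \prod_(j | j \notin J) P (W j @^-1` B j).
Proof.
move: {2}#|J| (erefl #|J|) => k; elim: k J A B => [|k IH] J A B Jk mA mB.
  move/eqP: Jk; rewrite cards_eq0 => /eqP->.
  rewrite !big_set0 sqrtr0 gaussianE eqxx /dirac indicE.
  have -> : \prod_(j | j \notin finset.set0) P (W j @^-1` B j)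
      = P [set w | forall j, j \in [set: 'I_n]%SET -> B j (W j w)].
    rewrite W_indep//; apply: eq_bigl => j; by rewrite !inE.
  have [A0|A0] := boolP (0%R \in A).
    rewrite mul1e; congr (P _); apply/seteqP; split => w /=.
      by case=> _ h j _; apply: h; rewrite inE.
    rewrite big_set0 => h; split; first by rewrite inE in A0.
    by move=> j _; apply: h; rewrite inE.
  rewrite mul0e -[RHS](measure0 P); congr (P _).
  apply/seteqP; split => w //=; rewrite big_set0 => -[Aw _].
  by move/negP: A0; apply; rewrite inE.
have /card_gt0P[i iJ] : (0 < #|J|)%N by rewrite Jk.
pose J' := J :\ i.
have J'k : #|J'| = k by move: Jk; rewrite (cardsD1 i) iJ => -[].
have iJ' : i \notin J' by rewrite !inE eqxx.
have notinJ' j : (j \notin J') = (j == i) || (j \notin J).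
  by rewrite !inE negb_and negbK.
have sumJ (F : 'I_n -> R) : (\sum_(j in J) F j = \sum_(j in J') F j + F i)%R.
  by rewrite (big_setD1 i)//= addrC.
pose E := [set w | forall j, j \notin J -> B j (W j w)].
have mE : measurable E.
  rewrite (_ : E = \bigcap_(j in [set j | j \notin J]) (W j @^-1` B j)).
    by apply: fin_bigcap_measurable => // j _; exact: measurable_RV_preimage.
  by apply/seteqP; split => w h j; apply: h.
pose e := \prod_(j | j \notin J) P (W j @^-1` B j).
have e0 : 0 <= e by apply: prode_ge0 => j _; exact: measure_ge0.
have e_fin : e \is a fin_num.
  by apply: prode_fin_num => j _; apply: fin_num_measure; exact: measurable_RV_preimage.
have fe0 : (0 <= fine e)%R by exact: fine_ge0.
pose r : {nonneg R} := NngNum fe0.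
pose G' := gaussian (\sum_(j in J') m j) (Num.sqrt (\sum_(j in J') s j ^+ 2)).
pose pr w := ((\sum_(j in J') W j w)%R : measurableTypeR R, W i w : measurableTypeR R).
have mpr : measurable_fun setT pr.
  by apply/measurable_fun_pair;
    [exact: (measurable_sum_RV J')|exact: (measurable_funPT (W i))].
(* nu is the law of the pair (sum over J', i-th weight) on the event E. It is
   a product measure because it has the right values on rectangles, and the
   sum over J is a function of the pair. *)
pose nu : {measure set (measurableTypeR R * measurableTypeR R) -> \bar R} :=
  pushforward (mrestr P mE) pr.
have nuE C : measurable C ->
    (G' \x mscale r (gaussian (m i) (s i))) C = nu mpr C.
  move=> mC; apply: (@product_measure_unique _ _ _ _ R G'
    (mscale r (gaussian (m i) (s i))) (nu mpr)) mC => A1 A2 mA1 mA2.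
  pose B' j : set R := if j == i then A2 else B j.
  have mB' j : measurable (B' j).
    by rewrite /B'; case: ifP => _; [exact: mA2|exact: mB].
  transitivity (P [set w | A1 (\sum_(j in J') W j w)%R /\
      forall j, j \notin J' -> B' j (W j w)]).
    congr (P _); apply/seteqP; split => w /=.
      move=> [[h1 h2] h3]; split=> // j; rewrite notinJ' /B'.
      by case: eqVneq => [->|_] //= jJ; exact: h3.
    move=> [h1 h2]; split; first split=> //.
      by have := h2 i; rewrite iJ' /B' eqxx; exact.
    move=> j jJ; have := h2 j; rewrite notinJ' jJ orbT /B' ifF; first exact.
    by apply: contraNF jJ => /eqP->.
  rewrite IH// [X in _ * X](bigD1 i)//= {1}/B' eqxx law//; congr (_ * _).
  rewrite /mscale [RHS]muleC /= fineK//; congr (_ * _).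
  apply: eq_big => [j|j /andP[_ ji]]; last by rewrite /B' (negPf ji).
  rewrite notinJ'; case: eqVneq => [->|_] /=; first by rewrite iJ.
  by rewrite andbT.
pose C : set (measurableTypeR R * measurableTypeR R) :=
  [set p | A (p.1 + p.2)%R].
have mC : measurable C.
  rewrite -[C]setTI; have : measurable_fun setT
    (fun p : measurableTypeR R * measurableTypeR R => (p.1 + p.2)%R : measurableTypeR R).
    exact: measurable_funD measurable_fst measurable_snd.
  by apply.
transitivity (nu mpr C).
  rewrite /nu /= /pushforward /mrestr; congr (P _); apply/seteqP.
  by split => w /=; rewrite sumJ.
rewrite -nuE//.
transitivity ((G' \x gaussian (m i) (s i)) C * e).
  rewrite /product_measure1 /mscale /comp /= -/e fineK//.
  rewrite ge0_integralZl// 1?muleC//.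
    exact: measurable_fun_xsection.
have conv := gaussian_convolution (\sum_(j in J') m j) (m i)
  (sqrtr_ge0 (\sum_(j in J') s j ^+ 2)) (s_ge0 i) mA.
rewrite -/e; congr (_ * _); apply: (etrans conv).
have V0 : (0 <= \sum_(j in J') s j ^+ 2)%R.
  by apply: sumr_ge0 => j _; exact: sqr_ge0.
rewrite (sqr_sqrtr V0) (sumJ m) (sumJ (fun j => s j ^+ 2)%R).
reflexivity.
Qed.

Lemma law_sum (J : {set 'I_n}) (A : set R) : measurable A ->
  P [set w | A (\sum_(j in J) W j w)%R]
  = gaussian (\sum_(j in J) m j) (Num.sqrt (\sum_(j in J) s j ^+ 2)) A.
Proof.
move=> mA; have := @joint_law_sum J A (fun=> setT) mA (fun=> measurableT).
rewrite [X in _ * X]big1 => [|j _]; last by rewrite preimage_setT probability_setT.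
rewrite mule1 => <-; congr (P _).
by apply/seteqP; split => w //= -[].
Qed.

End IndependentSum.

(** * The normal quantile and the chance constraint *)

Section StandardNormal.
Context {R : realType}.
Local Notation mu := (@lebesgue_measure R).
Local Open Scope ereal_scope.

Lemma normal_prob_itv_le (x y : R) : (x <= y)%R ->
  normal_prob 0 1 `]x, y] <= (normal_peak 1 * (y - x))%:E.
Proof.
move=> xy; rewrite /normal_prob.
apply: (@le_trans _ _ (\int[mu]_(z in `]x, y]) (normal_peak 1)%:E)).
  apply: ge0_le_integral => //=.
  - by move=> z _; rewrite lee_fin normal_pdf_ge0.
  - by apply/measurable_EFinP/measurable_funTS; exact: measurable_normal_pdf.
  - by move=> z _; rewrite lee_fin normal_pdf_ub.
rewrite integral_cst//= lebesgue_measure_itv/= lte_fin.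
move: xy; rewrite le_eqVlt => /predU1P[->|->]; last by rewrite -EFinB -EFinM.
by rewrite ltxx mule0 subrr mulr0.
Qed.

Lemma normal_prob_itv_gt0 (x y : R) : (x < y)%R -> 0 < normal_prob 0 1 `]x, y].
Proof.
move=> xy.
(* on ]x, y] the square is at most x^2 + y^2, which bounds the density below *)
pose c := (normal_peak 1 * expR (- (x ^+ 2 + y ^+ 2) / (1 ^+ 2 *+ 2)))%R.
have c0 : (0 < c)%R by rewrite mulr_gt0 ?expR_gt0 ?normal_peak_gt0.
apply: (@lt_le_trans _ _ (\int[mu]_(z in `]x, y]) c%:E)).
  rewrite integral_cst//= lebesgue_measure_itv/= lte_fin xy -EFinB -EFinM lte_fin.
  by rewrite mulr_gt0// subr_gt0.
apply: ge0_le_integral => //=.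
- by move=> z _; rewrite lee_fin ltW.
- by apply/measurable_EFinP/measurable_funTS; exact: measurable_normal_pdf.
- move=> z; rewrite in_itv/= => /andP[xz zy].
  rewrite lee_fin normal_pdfE// ler_pM2l ?normal_peak_gt0// ler_expR subr0.
  rewrite ler_pM2r ?invr_gt0 ?expr1n// lerN2.
  have x2 := sqr_ge0 x; have y2 := sqr_ge0 y.
  have [z0|z0] := leP 0%R z.
    have : (0 <= (y - z) * (y + z))%R by rewrite mulr_ge0//; lra.
    by rewrite -subr_sqr; lra.
  have : (0 <= (z - x) * (- (z + x)))%R by rewrite mulr_ge0//; lra.
  by rewrite mulrN -subr_sqr; lra.
Qed.

Lemma std_normal_cdfB (x y : R) : (x <= y)%R ->
  std_normal_cdf y = std_normal_cdf x + normal_prob 0 1 `]x, y].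
Proof.
move=> xy; rewrite /std_normal_cdf -measureU//.
  by congr normal_prob; rewrite -itv_bndbnd_setU.
apply/seteqP; split => z //=; rewrite !in_itv/= => -[zx /andP[xz _]].
by move: (lt_le_trans xz zx); rewrite ltxx.
Qed.

Lemma std_normal_cdf_fin (x : R) : std_normal_cdf x \is a fin_num.
Proof. exact: fin_num_measure. Qed.

Lemma std_normal_cdf_lt (x y : R) : (x < y)%R -> std_normal_cdf x < std_normal_cdf y.
Proof.
move=> xy; rewrite (std_normal_cdfB (ltW xy)) lteDl ?normal_prob_itv_gt0//.
exact: std_normal_cdf_fin.
Qed.

Lemma std_normal_cdf_le (x y : R) :
  (std_normal_cdf x <= std_normal_cdf y) = (x <= y)%R.
Proof.
have [xy|yx] := leP x y; last by apply/negbTE; rewrite -ltNge std_normal_cdf_lt.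
move: xy; rewrite le_eqVlt => /predU1P[->|/std_normal_cdf_lt/ltW->//].
exact: lexx.
Qed.

(** The density is even, so each half-line carries half of the mass. *)
Lemma std_normal_cdf0 : std_normal_cdf 0 = 2^-1%:E :> \bar R.
Proof.
have cpdf : continuous (@normal_pdf R 0 1) by exact: continuous_normal_pdf.
have even : @normal_pdf R 0 1 =1 @normal_pdf R 0 1 \o -%R.
  by move=> x /=; rewrite !normal_pdfE// /normal_fun !subr0 sqrrN.
have := ge0_symfun_integralT (@normal_pdf_ge0 R 0 1) cpdf even.
rewrite integral_normal_pdf -/(normal_prob 0 1 _).
have -> : [set x : R | (0 <= x)%R] = ~` `]-oo, 0%R[%classic.
  by apply/seteqP; split => x /=; rewrite in_itv/= leNgt => /negP.
rewrite probability_setC//= => h.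
have N0 : normal_prob 0 1 [set (0%R : R)] = 0.
  have /null_content_dominatesP dom := @normal_prob_dominates R 0 1.
  by apply: dom => //; exact: lebesgue_measure_set1.
have -> : std_normal_cdf 0 = normal_prob 0 1 `]-oo, (0%R : R)[.
  rewrite /std_normal_cdf -[RHS]adde0 -N0 -measureU//.
    by congr normal_prob; rewrite setUitv1.
  by apply/seteqP; split => x //=; rewrite in_itv/= => -[x0 xE]; move: x0; rewrite xE ltxx.
have : normal_prob 0 1 `]-oo, (0%R : R)[ \is a fin_num by exact: fin_num_measure.
move: h; case: (normal_prob 0 1 _) => [r| |]//= + _.
by rewrite -EFinB -EFinM => -[h]; congr EFin; lra.
Qed.

Lemma std_normal_cdf_lipschitz (x y : R) : (x <= y)%R ->
  (fine (std_normal_cdf y) - fine (std_normal_cdf x) <= normal_peak 1 * (y - x))%R.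
Proof.
move=> xy; rewrite -lee_fin EFinB !fineK ?std_normal_cdf_fin//.
rewrite (std_normal_cdfB xy) addeAC subee ?std_normal_cdf_fin// add0e.
exact: normal_prob_itv_le.
Qed.

Lemma continuous_std_normal_cdf : continuous (fun x : R => fine (std_normal_cdf x)).
Proof.
move=> x; apply/cvgrPdist_le => e e0.
have c0 : (0 < normal_peak 1 :> R)%R by rewrite normal_peak_gt0.
near=> y.
have : (`|x - y| <= e / normal_peak 1)%R.
  by near: y; apply: cvgr_dist_le; [exact: cvg_id|rewrite divr_gt0].
rewrite ler_pdivlMr// mulrC; apply: le_trans.
have mono (u v : R) : (u <= v)%R -> (fine (std_normal_cdf u) <= fine (std_normal_cdf v))%R.
  by move=> uv; rewrite fine_le ?std_normal_cdf_fin ?std_normal_cdf_le.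
have [xy|/ltW yx] := leP x y.
  rewrite distrC (distrC x) !ger0_norm ?subr_ge0 ?mono//.
  exact: std_normal_cdf_lipschitz.
rewrite !ger0_norm ?subr_ge0 ?mono//.
exact: std_normal_cdf_lipschitz.
Unshelve. all: by end_near.
Qed.

Lemma std_normal_cdf_cvg1 : (std_normal_cdf x @[x --> +oo%R] --> (1 : \bar R)).
Proof.
pose id_rv := HB.pack_for {RV (normal_prob (0 : R) 1) >-> R} (idfun : measurableTypeR R -> R)
   (@isMeasurableFun.Build _ _ (measurableTypeR R) R idfun (@measurable_id _ _ setT)).
have := cvg_cdfy1 id_rv.
by move=> /(_ (normal_prob 0 1)).
Qed.

(** The distribution function is continuous, at most p at 0 by
    [std_normal_cdf0], and above p far to the right. *)
Lemma std_normal_quantileP (p : R) : (2^-1 <= p < 1)%R ->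
  std_normal_cdf (std_normal_quantile p) = p%:E.
Proof.
move=> /andP[p2 p1]; rewrite /std_normal_quantile; case: xgetP => [x _//|noq].
have [b [b0 pb]] : exists b : R, (0 <= b)%R /\ (p < fine (std_normal_cdf b))%R.
  have : \forall x \near (+oo)%R, (0 <= x :> R)%R /\ (p < fine (std_normal_cdf x))%R.
    near=> x; split; first by near: x; exact: nbhs_pinfty_ge.
    near: x; have F1 : fine (std_normal_cdf x) @[x --> +oo%R] --> (1%R : R).
      by apply: fine_cvg; exact: std_normal_cdf_cvg1.
    exact: (cvgr_gt _ F1).
  by move=> /filter_ex.
have cF := continuous_subspaceT continuous_std_normal_cdf.
have [|x _ xp] := @IVT R (fun x => fine (std_normal_cdf x)) 0 b p b0 (cF _).
  by rewrite std_normal_cdf0 ge_min le_max /= p2 (ltW pb) orbT.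
by case: (noq x); rewrite /= -xp fineK// std_normal_cdf_fin.
Unshelve. all: by end_near.
Qed.

Lemma std_normal_quantile_ge0 (p : R) : (2^-1 <= p < 1)%R ->
  (0 <= std_normal_quantile p)%R.
Proof.
move=> p01; rewrite -std_normal_cdf_le std_normal_quantileP// std_normal_cdf0.
by rewrite lee_fin; case/andP: p01.
Qed.

End StandardNormal.

(** A normal law is the affine image of the standard one, whose distribution
    function is strictly increasing. For s = 0 both sides say m <= b, because
    0 < p <= 1. *)
Lemma gaussian_cdf_ge (R : realType) (p m s b : R) : 2^-1 <= p < 1 -> 0 <= s ->
  (p%:E <= gaussian m s `]-oo, b]%classic)%E = (m + std_normal_quantile p * s <= b).
Proof.
move=> p01 s0; rewrite gaussianE; have [->|sn0] := eqVneq s 0.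
  rewrite mulr0 addr0 /dirac indicE.
  have -> : (m \in `]-oo, b]%classic) = (m <= b).
    by apply/idP/idP; rewrite inE /= in_itv.
  case/andP: p01 => p2 p1; case: (m <= b); rewrite lee_fin ?(ltW p1)//.
  by apply/negbTE; rewrite -ltNge; apply: lt_le_trans p2; rewrite invr_gt0.
have s_gt0 : 0 < s by rewrite lt_neqAle eq_sym sn0.
rewrite -(std_normal_quantileP p01).
have := @normal_prob_affine R 0 1 s m `]-oo, b]%classic s_gt0 (oner_neq0 _).
rewrite mulr0 add0r mulr1 => <-//.
have -> : (fun x => s * x + m) @^-1` `]-oo, b]%classic = `]-oo, ((b - m) / s)]%classic.
  by apply/seteqP; split => x /=; rewrite !in_itv/= ler_pdivlMr// lerBrDr mulrC.
rewrite -/(std_normal_cdf _) std_normal_cdf_le ler_pdivlMr//.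
by rewrite lerBrDr addrC.
Qed.

Lemma quantile_ge0 (R : realType) (n : nat) (K : instance R n) :
  standing_assumptions K -> 0 <= quantile K.
Proof. by case=> _ _ h _ _; exact: std_normal_quantile_ge0. Qed.

(** For a 0/1 vector the total weight is the sum over the support, whose law
    is [law_sum], and x_j^2 = x_j, so the deterministic form of the constraint
    is the relaxed load. *)
Lemma ckp_feasibleE d (T : measurableType d) (R : realType)
    (P : probability T R) (n : nat) (K : instance R n)
    (W : 'I_n -> {RV P >-> R}) (x : 'I_n -> R) :
  standing_assumptions K -> random_weights K W ->
  ckp_feasible K W x <->
  (forall j, x j = 0 \/ x j = 1) /\ relaxed_load K x <= capacity K.
Proof.
move=> HK [Wlaw Windep]; rewrite /ckp_feasible.
have sg_ge0 j : 0 <= stdev K j by case: HK => /(_ j)[].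
have lev : 2^-1 <= level K < 1 by case: HK.
suff E : (forall j, x j = 0 \/ x j = 1) ->
    ((level K)%:E <= P [set w | (\sum_j W j w * x j <= capacity K)%R])%E
    = (relaxed_load K x <= capacity K).
  by split=> -[x01 xb]; split; rewrite // ?E// -E.
move=> x01; pose J := [set j | x j == 1]%SET.
have xE j : x j = (j \in J)%:R.
  by rewrite inE; case: (x01 j) => ->; rewrite ?eqxx// eq_sym oner_eq0.
have sumJ (F : 'I_n -> R) : \sum_j F j * x j = \sum_(j in J) F j.
  rewrite [RHS]big_mkcond; apply: eq_bigr => j _; rewrite xE.
  by case: ifP; rewrite ?mulr1 ?mulr0.
have -> : [set w | (\sum_j W j w * x j <= capacity K)%R]
   = [set w | `]-oo, capacity K]%classic (\sum_(j in J) W j w)].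
  by apply/seteqP; split => w /=; rewrite in_itv/= sumJ.
rewrite (law_sum sg_ge0 Wlaw Windep)// gaussian_cdf_ge ?sqrtr_ge0//.
by rewrite /relaxed_load !sumJ.
Qed.

(** * The greedy order and the critical item *)

Section ItemOrder.
Variables (R : realType) (n : nat) (K : instance R n).

(** At delta = 0 the items of positive variance come late; this flag is one
    more key of a lexicographic order. *)
Lemma precedesE delta k l : precedes K delta k l =
  let p := density K delta in
  let r j := stdev K j ^+ 2 / profit K j in
  let late j := (delta == 0) && (stdev K j != 0) in
  if late k == late l then
    (p l < p k) || (p k == p l) && ((r l < r k) || (r k == r l) && (k <= l)%N)
  else late l.
Proof.
rewrite /precedes /=; case: (delta == 0) => //=.
by case: (stdev K k == 0); case: (stdev K l == 0).
Qed.

Lemma precedes_refl delta : reflexive (precedes K delta).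
Proof. by move=> k; rewrite precedesE /= !eqxx leqnn /= !orbT. Qed.

Lemma precedes_anti delta : antisymmetric (precedes K delta).
Proof.
move=> k l; rewrite !precedesE /= (eq_sym (_ && (stdev K l != 0))).
case: ifP => [_|]; last by do 2![case: (_ && _)].
case: ltgtP => //= _; case: ltgtP => //= _ /anti_leq.
exact: val_inj.
Qed.

Lemma precedes_total delta : total (precedes K delta).
Proof.
move=> k l; rewrite !precedesE /= (eq_sym (_ && (stdev K l != 0))).
case: ifP => [_|]; last by do 2![case: (_ && _)].
by case: ltgtP => //= _; case: ltgtP => //= _; exact: leq_total.
Qed.

Lemma precedes_trans delta : transitive (precedes K delta).
Proof.
have lex_trans (p r : 'I_n -> R) : transitive (fun k l : 'I_n =>
    (p l < p k) || (p k == p l) && ((r l < r k) || (r k == r l) && (k <= l)%N)).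
  move=> l k m; case/orP=> [h1|/andP[/eqP-> ]].
    case/orP=> [h2|/andP[/eqP<- _]]; last by rewrite h1.
    by rewrite (lt_trans h2 h1).
  move=> h1 /orP[->//|/andP[->]]; case/orP: h1 => [h1|/andP[/eqP-> h1]].
    case/orP=> [h2|/andP[/eqP<- _]]; last by rewrite h1 orbT.
    by rewrite (lt_trans h2 h1) orbT.
  move=> /orP[->|/andP[-> h2]]; rewrite ?orbT//.
  by rewrite (leq_trans h1 h2) !orbT.
move=> l k m; rewrite !precedesE /=.
case: (_ && (stdev K k != 0)); case: (_ && (stdev K l != 0));
  by case: (_ && (stdev K m != 0)) => //=; exact: (lex_trans (density K delta)
    (fun j => stdev K j ^+ 2 / profit K j) l k m).
Qed.

Lemma precedesN delta k l : k != l -> precedes K delta k l = ~~ precedes K delta l k.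
Proof.
move=> kl; apply/idP/idP => [kl1|lk]; last first.
  by have := precedes_total delta k l; rewrite (negPf lk) orbF.
by apply/negP => lk; move: kl; rewrite (precedes_anti (introT andP (conj kl1 lk))) eqxx.
Qed.

Lemma tau_uniq delta : uniq (tau K delta).
Proof. by rewrite sort_uniq enum_uniq. Qed.

Lemma mem_tau delta k : k \in tau K delta.
Proof. by rewrite mem_sort mem_enum. Qed.

Lemma size_tau delta : size (tau K delta) = n.
Proof. by rewrite size_sort size_enum_ord. Qed.

Lemma comes_beforeE delta k l :
  comes_before K delta k l = precedes K delta k l && (k != l).
Proof.
have s : sorted (precedes K delta) (tau K delta).
  exact/sort_sorted/precedes_total.
have idx i j : comes_before K delta i j -> precedes K delta i j.
  by apply: (sorted_ltn_index (@precedes_trans delta) s); rewrite mem_tau.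
have [->|kl] /= := eqVneq k l; first by rewrite /comes_before ltnn andbF.
rewrite andbT; apply/idP/idP => [/idx//|kl1].
move: kl1; rewrite precedesN//; apply: contraNT; rewrite -leqNgt leq_eqVlt.
case/orP => [/eqP e|/idx//]; move: kl.
by rewrite -[k](nth_index k (mem_tau delta k)) -e nth_index ?mem_tau ?eqxx.
Qed.

Definition before delta k : pred 'I_n := [pred j | comes_before K delta j k].

Lemma mem_take_tau delta k j :
  (j \in take (index k (tau K delta)) (tau K delta)) = before delta k j.
Proof. by rewrite in_take ?mem_tau. Qed.

Lemma big_take_tau delta k (F : 'I_n -> R) :
  \sum_(j <- take (index k (tau K delta)) (tau K delta)) F j
  = \sum_(j | before delta k j) F j.
Proof.
rewrite big_uniq ?take_uniq ?tau_uniq//.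
by apply: eq_bigl => j; rewrite mem_take_tau.
Qed.

Lemma big_take_tauS delta k (F : 'I_n -> R) :
  \sum_(j <- take (index k (tau K delta)).+1 (tau K delta)) F j
  = \sum_(j | before delta k j) F j + F k.
Proof.
rewrite (take_nth k) ?index_mem ?mem_tau// nth_index ?mem_tau//.
by rewrite -cats1 big_cat /= big_seq1 big_take_tau.
Qed.

End ItemOrder.

Section Critical.
Variables (R : realType) (n : nat) (K : instance R n).
Hypothesis HK : standing_assumptions K.

Let quantile_ge0 : 0 <= quantile K. Proof. exact: quantile_ge0 HK. Qed.

Let a_gt0 j : 0 < mean K j. Proof. by case: HK => /(_ j)[]. Qed.
Let b_gt0 : 0 < capacity K. Proof. by case: HK. Qed.

Definition mean_before delta k := \sum_(j | before K delta k j) mean K j.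
Definition variance_before delta k :=
  \sum_(j | before K delta k j) stdev K j ^+ 2.
Definition profit_before delta k := \sum_(j | before K delta k j) profit K j.

(** Criticality in terms of the set of items before k, without positions in
    tau: it is the same at all delta for which this set is the same. *)
Definition critical delta k :=
  (mean_before delta k + quantile K * Num.sqrt (variance_before delta k)
     < capacity K) &&
  (capacity K <= mean_before delta k + mean K k
     + quantile K * Num.sqrt (variance_before delta k + stdev K k ^+ 2)).

Lemma sequence_load_cat s s' :
  sequence_load K s <= sequence_load K (s ++ s').
Proof.
rewrite /sequence_load !big_cat /= lerD//.
  by rewrite lerDl sumr_ge0// => j _; exact/ltW.
rewrite ler_wpM2l// ler_wsqrtr// lerDl sumr_ge0// => j _.
exact: sqr_ge0.
Qed.

Lemma sequence_load_take s i i' : (i <= i')%N ->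
  sequence_load K (take i s) <= sequence_load K (take i' s).
Proof.
move=> /subnKC <-; rewrite takeD; exact: sequence_load_cat.
Qed.

Lemma sequence_load_before delta k :
  sequence_load K (take (index k (tau K delta)) (tau K delta))
  = mean_before delta k + quantile K * Num.sqrt (variance_before delta k).
Proof. by rewrite /sequence_load !big_take_tau. Qed.

Lemma sequence_load_beforeS delta k :
  sequence_load K (take (index k (tau K delta)).+1 (tau K delta))
  = mean_before delta k + mean K k
     + quantile K * Num.sqrt (variance_before delta k + stdev K k ^+ 2).
Proof. by rewrite /sequence_load !big_take_tauS. Qed.

Lemma n_full_lt delta : (n_full K delta < n)%N.
Proof.
rewrite -[X in (_ < X)%N](size_iota 1 n) -has_find; apply/hasP.
have n_gt0 : (0 < n)%N.
  case: HK => _ _ _ + _; rewrite ltNge lt0n; apply: contraNneq => n0.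
  rewrite !big1 ?sqrtr0 ?mulr0 ?addr0 ?ltW// => j; exfalso;
  by have := ltn_ord j; rewrite [X in (_ < X)%N]n0.
exists n; first by rewrite mem_iota add1n ltnSn n_gt0.
rewrite take_oversize ?size_tau// /sequence_load.
case: HK => _ _ _ /ltW + _; rewrite /tau.
by rewrite !(perm_big _ (permEl (perm_sort _ _))) /= !big_enum.
Qed.

(** The load of the first i items increases with i, so it reaches the capacity
    at exactly one item. *)
Lemma criticalE delta k : critical delta k = (index k (tau K delta) == n_full K delta).
Proof.
set P := fun k => capacity K <= sequence_load K (take k (tau K delta)).
have fE : n_full K delta = find P (iota 1 n) by [].
have lt_n := n_full_lt delta.
have PS i i' : (i <= i')%N -> P i -> P i'.
  by move=> /(sequence_load_take (tau K delta)) ii'; move=> /le_trans; apply.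
have ltP : (index k (tau K delta) < n)%N.
  by rewrite -[X in (_ < X)%N](size_tau K delta) index_mem mem_tau.
rewrite /critical -sequence_load_before -sequence_load_beforeS ltNge -/(P _) -/(P _).
set i := index k _ in ltP *.
have Pn : P (n_full K delta).+1.
  have h : has P (iota 1 n) by rewrite has_find -fE size_iota.
  by have := nth_find 0%N h; rewrite -fE nth_iota// add1n.
have nP j : (j < (n_full K delta).+1)%N -> ~~ P j.
  case: j => [_|j jf].
    by rewrite /P take0 /sequence_load !big_nil sqrtr0 mulr0 addr0 -ltNge.
  have := @before_find _ 0%N P (iota 1 n) j; rewrite -fE => /(_ jf).
  have jn : (j < n)%N by apply: ltn_trans lt_n; rewrite -ltnS.
  by rewrite nth_iota ?add1n// => ->.
apply/andP/eqP => [[nPi Pi]|->]; last by rewrite nP.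
apply/eqP; rewrite eqn_leq; apply/andP; split; rewrite leqNgt; apply/negP => h.
  by move: nPi; rewrite (PS _ _ h Pn).
by have := nP i.+1 h; rewrite Pi.
Qed.

Lemma exists_critical delta : exists k, critical delta k.
Proof.
have lt_n := n_full_lt delta.
exists (nth (Ordinal lt_n) (tau K delta) (n_full K delta)).
by rewrite criticalE index_uniq ?size_tau ?tau_uniq.
Qed.

Lemma critical_uniq delta k k' : critical delta k -> critical delta k' -> k = k'.
Proof.
rewrite !criticalE => /eqP <- /eqP e.
by rewrite -[k](nth_index k (mem_tau K delta k)) -e nth_index ?mem_tau.
Qed.

(** The smaller root of the equation that defines [theta_star], for sums A of
    means and V of variances over the items before the critical one, whose own
    mean and variance are a and v. *)
Definition critical_fraction (A V a v : R) : R :=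
  let B := 2 * a * (capacity K - A) + quantile K ^+ 2 * v in
  (B - Num.sqrt (B ^+ 2 - 4 * a ^+ 2
      * ((capacity K - A) ^+ 2 - quantile K ^+ 2 * V))) / (2 * a ^+ 2).

(** Squaring may add a spurious root to the equation of the load. The smaller
    root is the true one: where the linear side b - A - a theta vanishes, the
    quadratic polynomial is nonpositive, so the smaller root lies to the left
    of that point, and there both sides are nonnegative before squaring. *)
Lemma critical_fractionP (A V a v : R) : 0 < a -> 0 <= v -> 0 <= V ->
  A + quantile K * Num.sqrt V < capacity K ->
  capacity K <= A + a + quantile K * Num.sqrt (V + v) ->
  let th := critical_fraction A V a v in
  [/\ 0 < th, th <= 1,
     A + a * th + quantile K * Num.sqrt (V + v * th) = capacity K &
     min_of [set theta : R | quantile K ^+ 2 * (V + v * theta)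
       = (capacity K - A - a * theta) ^+ 2] = th].
Proof.
move=> a0 v0 V0; set q := quantile K; set d := capacity K - A => lt1 le1 th.
set B := 2 * a * d + q ^+ 2 * v.
set D := B ^+ 2 - 4 * a ^+ 2 * (d ^+ 2 - q ^+ 2 * V).
have qV : q * Num.sqrt V < d by rewrite /d; lra.
have le2 : d - a <= q * Num.sqrt (V + v) by rewrite /d; lra.
have qV0 : 0 <= q * Num.sqrt V by rewrite mulr_ge0 ?sqrtr_ge0.
have d0 : 0 < d by exact: le_lt_trans qV.
have q2 : 0 <= q ^+ 2 by exact: sqr_ge0.
have DE : D = 4 * a * d * (q ^+ 2 * v) + (q ^+ 2 * v) ^+ 2
    + 4 * a ^+ 2 * (q ^+ 2 * V) by rewrite /D /B; ring.
have D0 : 0 <= D.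
  by rewrite DE !addr_ge0 ?sqr_ge0 ?mulr_ge0// ltW.
have B0 : 0 < B by rewrite /B ltr_pwDl ?mulr_gt0 ?mulr_ge0.
have sD : Num.sqrt D ^+ 2 = D by rewrite sqr_sqrtr.
have sD0 := sqrtr_ge0 D.
have a2 : 0 < 2 * a ^+ 2 by rewrite mulr_gt0 ?exprn_gt0.
have thE : 2 * a ^+ 2 * th = B - Num.sqrt D.
  by rewrite mulrC divfK// gt_eqF.
have factor x : (d - a * x) ^+ 2 - q ^+ 2 * (V + v * x)
   = ((2 * a ^+ 2 * x - B) ^+ 2 - D) / (4 * a ^+ 2).
  have a_neq0 : a != 0 by rewrite gt_eqF.
  by rewrite /D /B; field.
have root : q ^+ 2 * (V + v * th) = (d - a * th) ^+ 2.
  apply/esym/eqP; rewrite -subr_eq0 factor thE.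
  by rewrite addrAC subrr add0r sqrrN sD subrr mul0r.
have least x : q ^+ 2 * (V + v * x) = (d - a * x) ^+ 2 -> th <= x.
  move=> /esym/eqP; rewrite -subr_eq0 factor.
  rewrite mulf_eq0 invr_eq0 mulf_eq0 pnatr_eq0 /= expf_eq0 /= (gt_eqF a0) orbF.
  rewrite subr_eq0 => /eqP e; rewrite -(ler_pM2l a2) thE.
  have : `|2 * a ^+ 2 * x - B| = Num.sqrt D by rewrite -e sqrtr_sqr.
  have := ler_norm (- (2 * a ^+ 2 * x - B)); rewrite normrN => le eqD.
  by rewrite eqD in le; lra.
have th_gt0 : 0 < th.
  rewrite -(pmulr_rgt0 _ a2) thE subr_gt0 -[ltRHS]gtr0_norm// -sqrtr_sqr.
  rewrite ltr_sqrt ?exprn_gt0// /D ltrBlDl ltrDr mulr_gt0 ?mulr_gt0 ?exprn_gt0//.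
  rewrite subr_gt0 -[X in _ * X](sqr_sqrtr V0) -exprMn.
  by rewrite ltr_pXn2r ?nnegrE// ltW.
have left x : (d - a * x) ^+ 2 <= q ^+ 2 * (V + v * x) -> th <= x.
  rewrite -subr_le0 factor pmulr_lle0 ?invr_gt0 ?mulr_gt0 ?exprn_gt0//.
  rewrite subr_le0 => h; rewrite -(ler_pM2l a2) thE.
  have : `|2 * a ^+ 2 * x - B| <= Num.sqrt D.
    by rewrite -sqrtr_sqr ler_wsqrtr.
  by rewrite ler_norml => /andP[]; lra.
have thd : 0 <= d - a * th.
  have /left : (d - a * (d / a)) ^+ 2 <= q ^+ 2 * (V + v * (d / a)).
    rewrite [a * _]mulrC divfK ?gt_eqF// subrr expr0n /=.
    by rewrite mulr_ge0// addr_ge0// mulr_ge0// divr_ge0// ltW.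
  by rewrite ler_pdivlMr// mulrC subr_ge0.
have load : A + a * th + q * Num.sqrt (V + v * th) = capacity K.
  have -> : q * Num.sqrt (V + v * th) = Num.sqrt (q ^+ 2 * (V + v * th)).
    by rewrite sqrtrM// sqrtr_sqr ger0_norm.
  by rewrite root sqrtr_sqr ger0_norm// /d; ring.
split=> //.
- have [da|da] := leP 0 (d - a).
    apply: left; rewrite !mulr1 -[X in _ * X]sqr_sqrtr ?addr_ge0// -exprMn.
    by rewrite ler_pXn2r ?nnegrE ?mulr_ge0 ?sqrtr_ge0.
  by rewrite -(ler_pM2l a0) mulr1; lra.
- rewrite /min_of; apply: xget_unique; first by split; [exact: root|].
  move=> y [/= ry ly]; apply/eqP; rewrite eq_le least// andbT.
  by apply: ly.
Qed.
End Critical.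

(** * Greedy points dominate the points of their variance *)

Section Greedy.
Variables (R : realType) (n : nat) (K : instance R n).
Hypothesis HK : standing_assumptions K.

Let quantile_ge0 : 0 <= quantile K. Proof. exact: quantile_ge0 HK. Qed.

Let c_gt0 j : 0 < profit K j. Proof. by case: HK => /(_ j)[]. Qed.
Let a_gt0 j : 0 < mean K j. Proof. by case: HK => /(_ j)[]. Qed.
Let sg_ge0 j : 0 <= stdev K j. Proof. by case: HK => /(_ j)[]. Qed.

Definition greedy_fraction delta k :=
  critical_fraction K (mean_before K delta k) (variance_before K delta k)
    (mean K k) (stdev K k ^+ 2).

Lemma greedy_fractionP delta k : critical K delta k ->
  let th := greedy_fraction delta k in
  [/\ 0 < th, th <= 1,
     mean_before K delta k + mean K k * th + quantile K *
       Num.sqrt (variance_before K delta k + stdev K k ^+ 2 * th) = capacity K &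
     theta_star K (take (n_full K delta) (tau K delta)) k = th].
Proof.
move=> kc; have := kc; rewrite (criticalE HK) => /eqP <-.
rewrite /theta_star !big_take_tau.
case/andP: kc => *; apply: (critical_fractionP HK) => //.
- exact: sqr_ge0.
- by apply: sumr_ge0 => j _; exact: sqr_ge0.
Qed.

Lemma greedy_pointE delta k : critical K delta k ->
  greedy_point K delta =1 fun j => if before K delta k j then 1
    else if j == k then greedy_fraction delta k else 0.
Proof.
move=> kc j; have [_ _ _ thE] := greedy_fractionP kc.
rewrite /greedy_point; have := kc; rewrite (criticalE HK) => /eqP e.
rewrite -e in thE *; rewrite /before /comes_before /=; case: ifP => // _.
have [->|jk] := eqVneq j k; first by rewrite eqxx.
rewrite ifF//; apply: contra_neqF jk => /eqP ejk.
by rewrite -[j](nth_index j (mem_tau K delta j)) ejk nth_index ?mem_tau.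
Qed.

Lemma before_irr delta k : before K delta k k = false.
Proof. by rewrite /before /= comes_beforeE eqxx andbF. Qed.

Lemma sum_greedy_point delta k (F : 'I_n -> R) : critical K delta k ->
  \sum_j F j * greedy_point K delta j
  = \sum_(j | before K delta k j) F j + F k * greedy_fraction delta k.
Proof.
move=> kc; rewrite (bigD1 k)//= addrC [in LHS](bigID (before K delta k)) /=.
rewrite !(greedy_pointE kc) before_irr eqxx; congr (_ + _).
rewrite [X in _ + X]big1 ?addr0; last first.
  by move=> j /andP[jk /negPf bj]; rewrite (greedy_pointE kc) bj (negPf jk) mulr0.
apply: eq_big => [j|j /andP[_ bj]]; last by rewrite (greedy_pointE kc) bj mulr1.
by case: eqVneq => //= ->; rewrite before_irr.
Qed.

Lemma relaxed_load_greedy delta : relaxed_load K (greedy_point K delta) = capacity K.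
Proof.
have [k kc] := exists_critical HK delta.
rewrite /relaxed_load !(sum_greedy_point _ kc).
by have [_ _ + _] := greedy_fractionP kc.
Qed.

Lemma unit_box_greedy delta : unit_box (greedy_point K delta).
Proof.
move=> j; have [k kc] := exists_critical HK delta.
have [th0 th1 _ _] := greedy_fractionP kc.
rewrite (greedy_pointE kc); case: ifP => _; first by rewrite ler01 lexx.
by case: ifP => _; rewrite ?lexx ?ler01// th1 ltW.
Qed.

Lemma adjusted_meanE delta j : adjusted_mean K delta j
  = mean K j + quantile K / (2 * Num.sqrt delta) * stdev K j ^+ 2.
Proof.
rewrite /adjusted_mean; case: eqP => [->|//].
by rewrite sqrtr0 mulr0 invr0 mulr0 mul0r addr0.
Qed.

Lemma adjusted_mean_gt0 delta j : 0 < adjusted_mean K delta j.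
Proof.
by rewrite adjusted_meanE ltr_pwDl// !mulr_ge0 ?sqr_ge0 ?invr_ge0 ?mulr_ge0 ?sqrtr_ge0.
Qed.

Lemma precedes_density delta k l :
  (delta == 0) && (stdev K k != 0) = (delta == 0) && (stdev K l != 0) ->
  precedes K delta k l -> density K delta l <= density K delta k.
Proof.
rewrite precedesE /= => ->; rewrite eqxx => /orP[/ltW//|/andP[/eqP-> _]].
exact: lexx.
Qed.

(** With p the profit per weight w of the critical item, the change from x to
    z gains at least p times the weight that it adds. *)
Lemma le_objective_exchange (w x z : 'I_n -> R) (p : R) : 0 <= p ->
  (forall j, 0 <= (profit K j - p * w j) * (z j - x j)) ->
  \sum_j w j * x j <= \sum_j w j * z j -> objective K x <= objective K z.
Proof.
move=> p0 h wxz; rewrite /objective -subr_ge0 -sumrB.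
have -> : \sum_j (profit K j * z j - profit K j * x j) =
  \sum_j (profit K j - p * w j) * (z j - x j)
  + p * (\sum_j w j * z j - \sum_j w j * x j).
  rewrite -sumrB mulr_sumr -big_split /=; apply: eq_bigr => j _; ring.
by rewrite addr_ge0 ?sumr_ge0// mulr_ge0// subr_ge0.
Qed.

(** Before k the density is at least that of k and z is 1, after k it is at
    most that of k and z is 0, so both factors have the same sign. *)
Lemma greedy_exchange delta k (x : 'I_n -> R) j : critical K delta k ->
  unit_box x ->
  (delta == 0) && (stdev K j != 0) = (delta == 0) && (stdev K k != 0) ->
  0 <= (profit K j - density K delta k * adjusted_mean K delta j)
       * (greedy_point K delta j - x j).
Proof.
move=> kc /(_ j)/andP[x0 x1] jk; have w0 := adjusted_mean_gt0 delta.
have cE i : profit K i = density K delta i * adjusted_mean K delta i.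
  by rewrite /density divfK// gt_eqF.
rewrite cE -mulrBl (greedy_pointE kc) /before /= comes_beforeE.
have [->|jneqk] := eqVneq j k; first by rewrite subrr !mul0r.
rewrite andbT; case: ifPn => [/(precedes_density jk) le|].
  by rewrite !mulr_ge0 ?subr_ge0// ltW.
rewrite precedesN// negbK sub0r => /(precedes_density (esym jk)) le.
by rewrite mulrN -mulNr -mulNr mulr_ge0// mulr_ge0 ?(ltW (w0 _))// oppr_ge0 subr_le0.
Qed.

Lemma sqrt_tangent (d v : R) : 0 < d -> 0 <= v ->
  Num.sqrt v <= Num.sqrt d + (v - d) / (2 * Num.sqrt d).
Proof.
move=> d0 v0; have sd : 0 < Num.sqrt d by rewrite sqrtr_gt0.
rewrite -{2}(sqr_sqrtr v0) -{2}(sqr_sqrtr (ltW d0)).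
rewrite -subr_ge0.
have -> : Num.sqrt d + (Num.sqrt v ^+ 2 - Num.sqrt d ^+ 2) / (2 * Num.sqrt d) - Num.sqrt v
  = (Num.sqrt v - Num.sqrt d) ^+ 2 / (2 * Num.sqrt d).
  by field; rewrite gt_eqF.
by rewrite divr_ge0 ?sqr_ge0// mulr_ge0// ltW.
Qed.

Lemma variance_of_ge0 x : unit_box x -> 0 <= variance_of K x.
Proof.
move=> x01; apply: sumr_ge0 => j _; case/andP: (x01 j) => x0 _.
by rewrite mulr_ge0 ?sqr_ge0.
Qed.

Lemma sum_adjusted_mean delta (x : 'I_n -> R) :
  \sum_j adjusted_mean K delta j * x j
  = \sum_j mean K j * x j + quantile K / (2 * Num.sqrt delta) * variance_of K x.
Proof.
rewrite /variance_of mulr_sumr -big_split /=; apply: eq_bigr => j _.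
by rewrite adjusted_meanE mulrDl mulrA.
Qed.

(** For delta > 0 this is the exchange argument for the adjusted means: they
    come from the tangent of the square root at delta, so the linearized load
    equals the load at x and is at least the load at the greedy point. For
    delta = 0 the point x uses only items without variance, which come first
    in the order. *)
Lemma le_objective_greedy x : unit_box x -> relaxed_load K x <= capacity K ->
  objective K x <= objective K (greedy_point K (variance_of K x)).
Proof.
move=> x01 xb; have v0 := variance_of_ge0 x01.
move: (erefl (variance_of K x)) v0; move: {2 3 4}(variance_of K x) => delta vE v0.
have [k kc] := exists_critical HK delta.
have p0 : 0 <= density K delta k by rewrite divr_ge0 ?ltW ?adjusted_mean_gt0.
have z01 := unit_box_greedy delta.
have zb := relaxed_load_greedy delta.
have vz0 := variance_of_ge0 z01.
have [d0|/negPf d0] := eqVneq delta 0; last first.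
  have dgt0 : 0 < delta by rewrite lt_neqAle eq_sym d0.
  apply: (@le_objective_exchange (adjusted_mean K delta) _ _ _ p0) => [j|].
    by apply: greedy_exchange; rewrite ?d0.
  rewrite !sum_adjusted_mean vE.
  have := sqrt_tangent dgt0 vz0.
  move=> /(ler_wpM2l quantile_ge0); move: xb zb.
  rewrite /relaxed_load -/(variance_of K _) -/(variance_of K _) vE.
  have -> (A B : R) : quantile K * (A + B / (2 * Num.sqrt delta))
     = quantile K * A + quantile K / (2 * Num.sqrt delta) * B by ring.
  rewrite mulrBr; set vz := variance_of K _; set q := _ / _; lra.
have x_eq0 j : stdev K j != 0 -> x j = 0.
  move=> sj; move: vE; rewrite d0 => /eqP.
  rewrite psumr_eq0 => [/allP/(_ j)|i _]; last first.
    by case/andP: (x01 i) => xi0 _; rewrite mulr_ge0 ?sqr_ge0.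
  rewrite mem_index_enum => /(_ isT); rewrite mulf_eq0 expf_eq0 (negPf sj) /=.
  by move=> /eqP.
(* if the critical item has positive variance, the greedy point contains all
   the items that x can use *)
have [sk|sk] := eqVneq (stdev K k) 0; last first.
  apply: ler_sum => j _; rewrite ler_pM2l//.
  have [sj|/x_eq0->] := eqVneq (stdev K j) 0; last by case/andP: (z01 j).
  have jk : j != k by apply: contraNneq sk => <-; rewrite sj.
  rewrite (greedy_pointE kc) /before /= comes_beforeE jk andbT.
  rewrite precedesE /= d0 eqxx sj sk eqxx /=.
  by case/andP: (x01 j).
have z_eq0 j : stdev K j != 0 -> greedy_point K delta j = 0.
  move=> sj; have jk : j != k by apply: contraNneq sj => ->; rewrite sk.
  rewrite (greedy_pointE kc) /before /= comes_beforeE jk andbT (negPf jk).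
  by rewrite precedesE /= d0 eqxx sj sk eqxx.
have vz : variance_of K (greedy_point K delta) = 0.
  rewrite /variance_of big1// => j _.
  have [->|/z_eq0->] := eqVneq (stdev K j) 0.
    by rewrite expr2 !mul0r.
  by rewrite mulr0.
apply: (@le_objective_exchange (adjusted_mean K delta) _ _ _ p0) => [j|].
  have [sj|sj] := eqVneq (stdev K j) 0.
    by apply: greedy_exchange; rewrite ?sj ?sk.
  by rewrite z_eq0// x_eq0// subrr mulr0.
have loadE y : relaxed_load K y = \sum_j mean K j * y j
  + quantile K * Num.sqrt (variance_of K y) by [].
have sd : Num.sqrt delta = 0 by rewrite d0 sqrtr0.
rewrite !sum_adjusted_mean vz vE sd !mulr0 invr0 mulr0 mul0r addr0.
by move: xb zb; rewrite !loadE vz vE sd sqrtr0 mulr0 !addr0 => + ->.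
Qed.

End Greedy.

(** * Changes of the greedy order *)

Lemma last_point_le (R : realType) (s : seq R) (x y : R) : x <= y ->
  exists q, [/\ x <= q <= y, (q == x) || (q \in s)
    & forall p, p \in s -> ~~ (q < p <= y)].
Proof.
move=> xy; elim: s => [|p s [q [/andP[xq qy] qs qmax]]].
  by exists x; rewrite lexx xy eqxx.
have [/andP[qp py]|pN] := boolP (q < p <= y).
  exists p; split; first by rewrite py (le_trans xq (ltW qp)).
    by rewrite inE eqxx orbT.
  move=> p'; rewrite inE => /orP[/eqP->|/qmax]; first by rewrite ltxx.
  by apply: contra => /andP[pp' ->]; rewrite (lt_trans qp pp').
exists q; split; first by rewrite xq.
  by case/orP: qs => [->//|qs]; rewrite inE qs !orbT.
by move=> p'; rewrite inE => /orP[/eqP->|/qmax].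
Qed.

Lemma least_positive (R : realType) (s : seq R) :
  (forall p, p \in s -> p <= 0) \/
  exists c, [/\ c \in s, 0 < c & forall p, p \in s -> 0 < p -> c <= p].
Proof.
elim: s => [|p s IH]; first by left.
have [p0|p0] := leP p 0.
  case: IH => [s0|[c [cs c0 cmin]]].
    by left=> q; rewrite inE => /predU1P[->|/s0].
  right; exists c; split=> // [|q]; first by rewrite inE cs orbT.
  by rewrite inE => /predU1P[->|/cmin//]; rewrite ltNge p0.
right; case: IH => [s0|[c [cs c0 cmin]]].
  exists p; split=> // [|q]; first by rewrite inE eqxx.
  by rewrite inE => /predU1P[->//|/s0]; rewrite leNgt => /negPf->.
have [pc|cp] := leP p c.
  exists p; split=> // [|q]; first by rewrite inE eqxx.
  by rewrite inE => /predU1P[->//|/cmin h /h]; exact: le_trans.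
exists c; split=> // [|q]; first by rewrite inE cs orbT.
by rewrite inE => /predU1P[->|/cmin//]; rewrite (ltW cp).
Qed.

Section Crossing.
Variables (R : realType) (n : nat) (K : instance R n).
Hypothesis HK : standing_assumptions K.

Let quantile_ge0 : 0 <= quantile K. Proof. exact: quantile_ge0 HK. Qed.

Let c_gt0 j : 0 < profit K j. Proof. by case: HK => /(_ j)[]. Qed.

Definition unit_mean j := mean K j / profit K j.
Definition unit_variance j := stdev K j ^+ 2 / profit K j.

(** The parameter at which k and l have the same density, if there is one. The
    formula always yields a nonnegative number, because x / 0 = 0 and because
    of the square. *)
Definition crossing k l : R :=
  (quantile K / 2 * (unit_variance k - unit_variance l)
   / (unit_mean l - unit_mean k)) ^+ 2.

Lemma crossingC k l : crossing k l = crossing l k.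
Proof.
rewrite /crossing -(opprB (unit_variance l)) -(opprB (unit_mean k)).
by rewrite invrN !mulrN mulNr opprK.
Qed.

(** The inverse density: in 1 / sqrt delta it is affine, so two items exchange
    their order at most once. *)
Definition unit_cost delta j :=
  unit_mean j + quantile K / (2 * Num.sqrt delta) * unit_variance j.

Lemma densityE delta j : density K delta j = (unit_cost delta j)^-1.
Proof.
rewrite /density /unit_cost /unit_mean /unit_variance mulrA -mulrDl.
by rewrite -adjusted_meanE invf_div.
Qed.

Lemma unit_cost_gt0 delta j : 0 < unit_cost delta j.
Proof. by rewrite -invr_gt0 -densityE divr_gt0 ?adjusted_mean_gt0. Qed.

Lemma precedes_gt0E delta k l : 0 < delta -> precedes K delta k l =
  (unit_cost delta k < unit_cost delta l)
  || (unit_cost delta k == unit_cost delta l) &&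
     ((unit_variance l < unit_variance k)
      || (unit_variance k == unit_variance l) && (k <= l)%N).
Proof.
move=> d0; rewrite /precedes (gt_eqF d0) andFb !densityE.
rewrite ltf_pV2 ?posrE ?unit_cost_gt0//.
by rewrite (inj_eq invr_inj).
Qed.

Lemma precedes_eq_variance x y k l : 0 < x -> 0 < y ->
  unit_variance k = unit_variance l -> precedes K x k l = precedes K y k l.
Proof.
move=> x0 y0 e; rewrite !precedes_gt0E// /unit_cost e.
by rewrite !(inj_eq (addIr _)) !ltrD2r.
Qed.

Lemma precedes_lt_variance x k l : 0 < x ->
  unit_variance l < unit_variance k -> precedes K x k l =
  (quantile K / 2 * (unit_variance k - unit_variance l)
    <= Num.sqrt x * (unit_mean l - unit_mean k)).
Proof.
move=> x0 lk; rewrite precedes_gt0E// lk /= andbT.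
rewrite orbC -le_eqVlt /unit_cost.
have sx : 0 < Num.sqrt x by rewrite sqrtr_gt0.
have sx' : 0 < (Num.sqrt x)^-1 by rewrite invr_gt0.
rewrite -[RHS](ler_pM2l sx').
rewrite mulKf ?gt_eqF// -[LHS]subr_ge0 -[RHS]subr_ge0; congr (0 <= _).
by field; rewrite gt_eqF.
Qed.

Lemma precedes_crossing x k l : 0 < x ->
  unit_variance l < unit_variance k -> unit_mean k < unit_mean l ->
  precedes K x k l = (crossing k l <= x).
Proof.
move=> x0 lk kl; rewrite precedes_lt_variance//.
rewrite -ler_pdivrMr ?subr_gt0// -{2}(sqr_sqrtr (ltW x0)) /crossing.
rewrite ler_pXn2r ?nnegrE// ?sqrtr_ge0// divr_ge0 ?mulr_ge0 ?divr_ge0 ?subr_ge0//.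
  exact: ltW.
exact: ltW.
Qed.

Lemma precedes_no_crossing x y k l : 0 < x -> 0 < y ->
  unit_variance l < unit_variance k -> unit_mean l <= unit_mean k ->
  precedes K x k l = precedes K y k l.
Proof.
move=> x0 y0 lk kl.
suff E z : 0 < z ->
    precedes K z k l = (quantile K == 0) && (unit_mean l == unit_mean k).
  by rewrite !E.
move=> z0; rewrite precedes_lt_variance//.
have sz : 0 < Num.sqrt z by rewrite sqrtr_gt0.
have L0 : 0 <= quantile K / 2 * (unit_variance k - unit_variance l).
  by rewrite mulr_ge0 ?divr_ge0// subr_ge0 ltW.
apply/idP/andP => [le|[/eqP-> /eqP->]]; last by rewrite subrr mulr0 mul0r mul0r.
have := le_trans L0 le; rewrite pmulr_rge0// subr_ge0 => kl'.
have /eqP e : unit_mean l == unit_mean k by rewrite eq_le kl kl'.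
split; last exact/eqP.
move: le; rewrite e subrr mulr0 pmulr_lle0 ?subr_gt0// pmulr_lle0 ?invr_gt0//.
by move=> q0; rewrite eq_le q0 quantile_ge0.
Qed.

(** If r_l < r_k then k overtakes l exactly from their crossing on, ties being
    broken in favour of k, and never otherwise. So a change of order on ]x, y]
    takes place at the crossing, which is then a reverse point. *)
Lemma precedes_change x y k l : 0 < x -> x <= y ->
  precedes K x k l != precedes K y k l ->
  x < crossing k l <= y /\ reverse_point K k l (crossing k l).
Proof.
move=> x0 xy.
have y0 := lt_le_trans x0 xy.
have [<-|kl] := eqVneq k l; first by rewrite !precedes_refl eqxx.
have main i j : unit_variance j < unit_variance i ->
    precedes K x i j != precedes K y i j ->
    [/\ x < crossing i j, crossing i j <= y,
        unit_cost (crossing i j) i = unit_cost (crossing i j) j &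
      forall z, 0 < z -> precedes K z i j = (crossing i j <= z)].
  move=> ji; have [ij|ij] := leP (unit_mean j) (unit_mean i).
    by rewrite (precedes_no_crossing x0 y0 ji ij) eqxx.
  have E z : 0 < z -> precedes K z i j = (crossing i j <= z).
    by move=> z0; exact: precedes_crossing.
  rewrite !E// => ch.
  have [cx cy] : x < crossing i j /\ crossing i j <= y.
    move: ch; case: leP => [cx|xc]; first by rewrite (le_trans cx xy).
    by case: leP.
  have q0 := lt_trans x0 cx.
  split=> //.
  have qi : 0 < unit_mean j - unit_mean i by rewrite subr_gt0.
  have ri : 0 <= unit_variance i - unit_variance j by rewrite subr_ge0 ltW.
  have sq : Num.sqrt (crossing i j) =
      quantile K / 2 * (unit_variance i - unit_variance j)
       / (unit_mean j - unit_mean i).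
    by rewrite /crossing sqrtr_sqr ger0_norm// divr_ge0 ?(ltW qi)// mulr_ge0 ?divr_ge0.
  have e : Num.sqrt (crossing i j) * (unit_mean j - unit_mean i) =
      quantile K / 2 * (unit_variance i - unit_variance j).
    by rewrite sq divfK// gt_eqF.
  have s0 := q0; rewrite -sqrtr_gt0 in s0.
  apply/eqP; rewrite -subr_eq0 /unit_cost.
  move: (crossing i j) => q in s0 e *.
  have -> : unit_mean i + quantile K / (2 * Num.sqrt q) * unit_variance i -
      (unit_mean j + quantile K / (2 * Num.sqrt q) * unit_variance j)
      = (quantile K / 2 * (unit_variance i - unit_variance j)
         - Num.sqrt q * (unit_mean j - unit_mean i)) / Num.sqrt q.
    by field; rewrite gt_eqF.
  by rewrite e subrr mul0r.
have near_lt (q : R) : 0 < q -> \forall alpha \near (0 : R)^'+, 0 < q - alpha < q.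
  move=> q0; near=> alpha.
  have a0 : 0 < alpha by near: alpha; exact: nbhs_right_gt.
  have aq : alpha < q by near: alpha; exact: nbhs_right_lt.
  by rewrite subr_gt0 aq ltrBlDr ltrDl.
case: (ltgtP (unit_variance k) (unit_variance l)) => vkl ch.
- have lk : l != k by rewrite eq_sym.
  rewrite crossingC; have := main l k vkl; rewrite !(precedesN _ _ lk).
  rewrite (inj_eq negb_inj) => /(_ ch)[cx cy ce cE].
  have q0 := lt_trans x0 cx.
  rewrite cx cy; split=> //; split=> //.
    by rewrite !densityE ce.
  near=> alpha; rewrite !comes_beforeE kl !andbT.
  have /andP[h1 h2] : 0 < crossing l k - alpha < crossing l k.
    by near: alpha; exact: near_lt.
  by rewrite !(precedesN _ _ kl) (cE _ h1) (cE _ q0) lexx leNgt h2.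
- have [cx cy ce cE] := main k l vkl ch.
  have q0 := lt_trans x0 cx.
  rewrite cx cy; split=> //; split=> //.
    by rewrite !densityE ce.
  near=> alpha; rewrite !comes_beforeE kl !andbT.
  have /andP[h1 h2] : 0 < crossing k l - alpha < crossing k l.
    by near: alpha; exact: near_lt.
  by rewrite (cE _ h1) (cE _ q0) lexx leNgt h2.
- by move: ch; rewrite (precedes_eq_variance x0 y0 vkl) eqxx.
Unshelve. all: by end_near.
Qed.

(** Reverse points are bounded below by positive crossings, of which there are
    finitely many; this is what makes gamma exist. *)
Lemma reverse_point_crossing k l q :
  reverse_point K k l q -> 0 < crossing k l <= q.
Proof.
move=> [q0 _ ch].
have : \forall alpha \near (0 : R)^'+, [/\ 0 < alpha, alpha < q &
    comes_before K (q - alpha) k l != comes_before K q k l].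
  near=> alpha; split.
  - by near: alpha; exact: nbhs_right_gt.
  - by near: alpha; exact: nbhs_right_lt.
  - by near: alpha.
move=> /(@filter_ex _ _ _)[alpha [a0 aq]]; rewrite !comes_beforeE.
have qa : 0 < q - alpha by rewrite subr_gt0.
have qaq : q - alpha <= q by rewrite lerBlDr lerDl ltW.
have [->|kl] := eqVneq k l; first by rewrite !andbF.
rewrite !andbT => /(precedes_change qa qaq)[/andP[h ->] _].
by rewrite (lt_trans qa h).
Unshelve. all: by end_near.
Qed.

End Crossing.

(** * Optimality of the best candidate *)

Section Candidates.
Variables (R : realType) (n : nat) (K : instance R n).
Hypothesis HK : standing_assumptions K.

Let box := prod_topology (fun _ : 'I_n => R).

Lemma continuous_weighted_sum (w : 'I_n -> R) :
  continuous (fun x : box => \sum_j w j * x j).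
Proof.
apply: (@continuous_big R 'I_n +%R 0 predT _ box _
  (fun j (x : box) => w j * x j)); first exact: add_continuous.
move=> j _ x.
have xj : (fun y : box => y j) y @[y --> x] --> x j.
  exact: (@proj_continuous _ (fun=> R) j).
exact: (cvg_comp _ _ xj (@mulrl_continuous R (w j) (x j))).
Qed.

(** The maximum that defines [delta_U] has to be attained, since its default
    value is 0: the feasible set is closed in a product of compact
    intervals. *)
Lemma variance_le_delta_U x : unit_box x -> relaxed_load K x <= capacity K ->
  variance_of K x <= delta_U K.
Proof.
move=> x01 xb.
have cV : continuous (variance_of K : box -> R).
  exact: (@continuous_weighted_sum (fun j => stdev K j ^+ 2)).
have cL : continuous (relaxed_load K : box -> R).
  move=> y; have c1 := @continuous_weighted_sum (mean K) y.
  have c2 := cvg_comp _ _ (cV y) (@sqrt_continuous R (variance_of K y)).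
  have c3 := cvg_comp _ _ c2 (@mulrl_continuous R (quantile K) _).
  exact: (cvgD c1 c3).
pose A : set box := [set x | unit_box x /\ relaxed_load K x <= capacity K].
have cbox : compact [set x : box | unit_box x].
  have -> : [set x : box | unit_box x]
      = [set x : box | forall j, `[0, 1]%classic (x j)].
    by apply/seteqP; split=> y /= h j; have := h j; rewrite in_itv.
  exact: (@tychonoff 'I_n (fun=> R) (fun=> `[0, 1]%classic)
    (fun=> @segment_compact R 0 1)).
have cA : compact A.
  have clL : closed [set x : box | relaxed_load K x <= capacity K].
    by apply: (preimage_closed _ (@closed_le R (capacity K))) => y _; exact: cL.
  exact: (compact_closedI cbox clL).
have [|y yA ymax] := compact_EVT_max _ cA (continuous_subspaceT cV).
  by exists x.
rewrite /delta_U /max_of; set B := _ `&` _.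
have By : B (variance_of K y).
  split; first by exists y => //; exact/set_mem.
  by move=> _ [z zA <-]; apply: ymax; exact/mem_set.
case: xgetP => [m _ [_ mB]|/(_ _ By)//].
by apply: mB; exists x.
Qed.

(** If the minimum were not attained, its default value 0 would still be a
    lower bound. *)
Lemma delta_L_le x : unit_box x -> capacity K <= relaxed_load K x ->
  delta_L K <= variance_of K x.
Proof.
move=> x01 xb; rewrite /delta_L /min_of; case: xgetP => [m _ [_ mB]|_].
  by apply: mB; exists x.
exact: variance_of_ge0.
Qed.

Lemma variance_greedy delta :
  delta_L K <= variance_of K (greedy_point K delta) <= delta_U K.
Proof.
have l := relaxed_load_greedy HK delta.
by rewrite delta_L_le ?variance_le_delta_U ?l//; exact: unit_box_greedy.
Qed.

Lemma precedes_eq x y : 0 < x -> x <= y ->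
  (forall k l, k != l -> reverse_point K k l (crossing K k l) ->
     ~~ (x < crossing K k l <= y)) ->
  precedes K x = precedes K y.
Proof.
move=> x0 xy noQ; apply/funext => k; apply/funext => l.
apply/eqP; apply: contraT => ch.
have [h rp] := precedes_change HK x0 xy ch.
have kl : k != l by apply: contraNneq ch => ->; rewrite !precedes_refl.
by have := noQ _ _ kl rp; rewrite h.
Qed.

Lemma greedy_point_eq x y : precedes K x = precedes K y ->
  greedy_point K x = greedy_point K y.
Proof. by move=> e; rewrite /greedy_point /n_full /tau e. Qed.

(** The order is constant between reverse points, so delta > 0 can be moved
    down to the last reverse point that is at most delta, or to
    max delta_L gamma if that comes later. If delta < gamma, then delta_L
    is also below gamma, and delta can be moved up to gamma. *)
Lemma exists_candidate gamma delta : below_reverse_points K gamma ->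
  0 <= delta -> delta_L K <= delta <= delta_U K ->
  exists2 q, candidates K gamma q & greedy_point K q = greedy_point K delta.
Proof.
move=> [g0 gQ]; rewrite le_eqVlt => /predU1P[<- h|d0 /andP[Ld dU]].
  by exists 0 => //; left; split => //; left; left.
have [dg|gd] := ltP delta gamma.
  exists (Num.max (delta_L K) gamma); first by right.
  rewrite max_r; last exact: le_trans (ltW dg).
  apply/esym/greedy_point_eq/precedes_eq => //; first exact: ltW.
  move=> k l kl rp; rewrite negb_and -ltNge gQ ?orbT//.
  by exists k, l.
set m := Num.max (delta_L K) gamma.
have md : m <= delta by rewrite ge_max Ld.
have m0 : 0 < m by rewrite lt_max g0 orbT.
pose s := [seq q <- [seq crossing K p.1 p.2 | p <- enum {: 'I_n * 'I_n}]
             | `[< reverse_points K q >]].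
have [q [/andP[mq qd] qs qmax]] := last_point_le s md.
exists q; last first.
  apply/greedy_point_eq/precedes_eq => //; first exact: lt_le_trans mq.
  move=> k l kl rp; apply: qmax; rewrite mem_filter; apply/andP; split.
    by apply/asboolP; exists k, l.
  by apply/mapP; exists (k, l); rewrite ?mem_enum.
case/orP: qs => [/eqP->|]; first by right.
rewrite mem_filter => /andP[/asboolP Qq _]; left; split; first by right.
by rewrite (le_trans _ mq) ?le_max ?lexx// (le_trans qd).
Qed.

(** The point x is compared with the greedy point for the variance of x, and
    that point with the greedy point for its own variance, which lies between
    delta_L and delta_U and so belongs to a candidate. *)
Lemma best_candidate_max gamma q x : below_reverse_points K gamma ->
  best_candidate K gamma q -> unit_box x -> relaxed_load K x <= capacity K ->
  objective K x <= objective K (greedy_point K q).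
Proof.
move=> gP [_ qmax] x01 xb.
have z01 := unit_box_greedy HK (variance_of K x).
have zb : relaxed_load K (greedy_point K (variance_of K x)) <= capacity K.
  by rewrite (relaxed_load_greedy HK).
have [q' cq' eq'] := exists_candidate gP (variance_of_ge0 K z01)
  (variance_greedy (variance_of K x)).
apply: le_trans (qmax _ cq'); rewrite eq'.
exact: le_trans (le_objective_greedy HK x01 xb)
  (le_objective_greedy HK z01 zb).
Qed.

(** Passing from delta to the variance of its greedy point does not lower the
    value, and leads into the range of the candidates. *)
Lemma exists_best_candidate gamma delta : below_reverse_points K gamma ->
  (forall delta', 0 <= delta' ->
    objective K (greedy_point K delta') <= objective K (greedy_point K delta)) ->
  exists2 q, best_candidate K gamma q &
    greedy_point K q
    = greedy_point K (variance_of K (greedy_point K delta)).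
Proof.
move=> gP dmax.
have zb d : relaxed_load K (greedy_point K d) <= capacity K.
  by rewrite (relaxed_load_greedy HK).
have z01 := unit_box_greedy HK.
have [q cq eq] := exists_candidate gP (variance_of_ge0 K (z01 delta))
  (variance_greedy delta).
exists q; last exact: eq.
split; first exact: cq.
move=> q' _; rewrite eq.
have le d := le_objective_greedy HK (z01 d) (zb d).
apply: le_trans (le delta); apply: le_trans (le q') _.
exact: dmax (variance_of_ge0 K (z01 q')).
Qed.

Lemma exists_below_reverse_points : exists gamma, below_reverse_points K gamma.
Proof.
pose s := [seq crossing K p.1 p.2 | p <- enum {: 'I_n * 'I_n}].
have [g g0 gs] : exists2 g : R, 0 < g & {in s, forall q, 0 < q -> g < q}.
  have [s0|[c [_ c0 cmin]]] := least_positive s.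
    by exists 1 => // q /s0; rewrite leNgt => /negP.
  exists (c / 2) => [|q qs q0]; first by rewrite divr_gt0.
  by rewrite (lt_le_trans _ (cmin q qs q0))// ltr_pdivrMr// ltr_pMr// ltr1n.
exists g; split=> // q [k [l [_ /(reverse_point_crossing HK)/andP[c0 cq]]]].
apply: lt_le_trans cq; apply: gs => //.
by apply/mapP; exists (k, l); rewrite ?mem_enum.
Qed.

End Candidates.

(** * Rounding the greedy point *)

Section Rounding.
Variables (R : realType) (n : nat) (K : instance R n).
Hypothesis HK : standing_assumptions K.

Let quantile_ge0 : 0 <= quantile K. Proof. exact: quantile_ge0 HK. Qed.

Let c_gt0 j : 0 < profit K j. Proof. by case: HK => /(_ j)[]. Qed.
Let a_gt0 j : 0 < mean K j. Proof. by case: HK => /(_ j)[]. Qed.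

Lemma le_relaxed_load (x y : 'I_n -> R) : (forall j, x j <= y j) ->
  relaxed_load K x <= relaxed_load K y.
Proof.
move=> xy; rewrite /relaxed_load lerD//.
  by apply: ler_sum => j _; rewrite ler_pM2l.
rewrite ler_wpM2l// ler_wsqrtr// ler_sum// => j _.
by rewrite ler_wpM2l ?sqr_ge0.
Qed.

Lemma round_downE (x : 'I_n -> R) j : unit_box x ->
  round_down x j = (x j == 1)%:R.
Proof.
move=> /(_ j)/andP[x0 x1]; rewrite /round_down.
have [->|xn1] := eqVneq (x j) 1; first by rewrite floor1.
by rewrite (_ : Num.floor _ = 0)//; apply: floor_def; rewrite x0 lt_neqAle xn1.
Qed.

(** A single item fits by the last standing assumption. *)
Lemma relaxed_load_unit_point t : relaxed_load K (unit_point R t) <= capacity K.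
Proof.
have unit_sum (F : 'I_n -> R) : \sum_j F j * unit_point R t j = F t.
  rewrite (bigD1 t)//= /unit_point eqxx mulr1 big1 ?addr0// => j /negPf->.
  by rewrite mulr0.
case: HK => /(_ t)[_ _ s0] _ _ _ /(_ t).
by rewrite /relaxed_load !unit_sum sqrtr_sqr ger0_norm.
Qed.

Lemma better_rounding_feasible x : is_xA K x ->
  (forall j, x j = 0 \/ x j = 1) /\ relaxed_load K x <= capacity K.
Proof.
move=> [g [q [t [_ _ _ ->]]]]; rewrite /better_rounding; case: ifP => _.
  have z01 := unit_box_greedy HK q.
  split=> [j|]; first by rewrite round_downE//; case: eqP; [right|left].
  rewrite -[leRHS](relaxed_load_greedy HK q).
  apply: le_relaxed_load => j; rewrite round_downE//.
  by case: eqP => [->//|_]; case/andP: (z01 j).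
split; last exact: relaxed_load_unit_point.
by move=> j; rewrite /unit_point; case: eqP; [right|left].
Qed.

(** The fractional coordinate, if there is one, is that of the critical item
    and hence t. *)
Lemma greedy_point_le_rounding q t j : fractional_index (greedy_point K q) t ->
  greedy_point K q j <= round_down (greedy_point K q) j + unit_point R t j.
Proof.
have z01 := unit_box_greedy HK q.
have [k kc] := exists_critical HK q.
have zN i : i != k -> ~~ (0 < greedy_point K q i < 1).
  move=> ik; rewrite (greedy_pointE HK kc) (negPf ik).
  by case: ifP; rewrite ltxx ?andbF.
move=> tf; rewrite round_downE// /unit_point.
have [->|jt] := eqVneq j t.
  by case/andP: (z01 t) => _ z1; rewrite (le_trans z1)// lerDr.
have : ~~ (0 < greedy_point K q j < 1).
  case: tf => [tf|[zf _]]; last exact: zf.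
  have /eqP tk : t == k by apply: contraLR tf; exact: zN.
  by apply: zN; rewrite -tk.
case/andP: (z01 j) => z0 z1; rewrite addr0.
rewrite [0 < _]lt_neqAle [_ < 1]lt_neqAle z0 z1 !andbT negb_and !negbK.
by case/orP => [/eqP<-|/eqP->]; rewrite ?eqxx.
Qed.

Lemma better_rounding_half x y : is_xA K x ->
  unit_box y -> relaxed_load K y <= capacity K ->
  1 / 2 * objective K y <= objective K x.
Proof.
move=> [g [q [t [gP qb tf ->]]]] y01 yb.
have := best_candidate_max HK gP qb y01 yb.
set z := greedy_point K q => yz.
have : objective K z <= objective K (round_down z) + objective K (unit_point R t).
  rewrite /objective -big_split /=; apply: ler_sum => j _.
  by rewrite -mulrDr ler_pM2l// greedy_point_le_rounding.
rewrite /better_rounding.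
case: (leP (objective K (unit_point R t)) (objective K (round_down z))) => ? ?; lra.
Qed.

End Rounding.

(** * Finitely many test parameters for each item *)

Section Coverage.
Variables (R : realType) (n : nat) (K : instance R n).
Hypothesis HK : standing_assumptions K.

Lemma before_eq x y k : 0 < x -> x <= y ->
  (forall l, ~~ (x < crossing K k l <= y)) -> before K x k =1 before K y k.
Proof.
move=> x0 xy noc j; rewrite /before /= !comes_beforeE; congr (_ && _).
apply/eqP; apply: contraT => ch.
have [h _] := precedes_change HK x0 xy ch.
by have := noc j; rewrite crossingC h.
Qed.

Lemma critical_before_eq x y k : before K x k =1 before K y k ->
  critical K x k = critical K y k.
Proof.
move=> e; rewrite /critical /mean_before /variance_before.
by rewrite !(eq_bigl _ _ e).
Qed.

Lemma greedy_before_eq x y k : before K x k =1 before K y k ->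
  critical K y k -> greedy_point K x =1 greedy_point K y.
Proof.
move=> e ky; have kx : critical K x k by rewrite (critical_before_eq e).
move=> j; rewrite (greedy_pointE HK kx) (greedy_pointE HK ky) e.
rewrite /greedy_fraction /mean_before /variance_before.
by rewrite !(eq_bigl _ _ e).
Qed.

Definition test_point k q :=
  q = 1 \/ exists l, q = crossing K k l \/ q = crossing K k l / 2.

(** Let k be critical at delta > 0. From the last positive crossing of k up to
    delta, the items before k stay the same. If all positive crossings of k
    exceed delta, half of the least one can replace delta, and if there is
    none, 1 can. The degenerate crossing of k with itself is 0, which takes
    care of delta = 0. *)
Lemma test_points_cover (v : R) :
  (forall k q, test_point k q -> critical K q k ->
     objective K (greedy_point K q) <= v) ->
  forall delta, 0 <= delta -> objective K (greedy_point K delta) <= v.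
Proof.
move=> tested_at delta d0.
have [k kc] := exists_critical HK delta.
have transfer q : test_point k q -> before K q k =1 before K delta k ->
    objective K (greedy_point K delta) <= v.
  move=> tq e; have qc : critical K q k by rewrite (critical_before_eq e).
  rewrite (_ : objective K _ = objective K (greedy_point K q)); last first.
    by apply: eq_bigr => j _; rewrite (greedy_before_eq e kc).
  exact: tested_at tq qc.
move: d0; rewrite le_eqVlt => /predU1P[d0|d0].
  apply: (transfer 0); last by rewrite d0.
  right; exists k; left; rewrite /crossing !subrr invr0 mulr0 expr0n.
  by [].
pose s := [seq crossing K k l | l <- enum 'I_n].
have ms l : crossing K k l \in s by apply/map_f; rewrite mem_enum.
have sm c : c \in s -> exists l, c = crossing K k l.
  by move=> /mapP[l _ ->]; exists l.
have same x y : 0 < x -> 0 < y ->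
    (forall l, 0 < crossing K k l -> Num.max x y < crossing K k l) ->
    before K x k =1 before K y k.
  move=> x0 y0 h; have noc z l : ~~ (0 < z) || ~~ (z < crossing K k l <= Num.max x y).
    rewrite -negb_and; apply/negP => /and3P[z0 zc cm].
    by have := h l (lt_trans z0 zc); rewrite ltNge cm.
  have [xy|/ltW yx] := leP x y.
    apply: before_eq => // l; have := noc x l.
    by rewrite x0 max_r.
  move=> j; symmetry; move: j; apply: before_eq => // l; have := noc y l.
  by rewrite y0 max_l.
have [s0|[c [cs c0 cmin]]] := least_positive s.
  apply: (transfer 1); first by left.
  by apply: same => // l; rewrite ltNge s0.
have [l cl] := sm _ cs.
have [cd|dc] := leP c delta; last first.
  apply: (transfer (c / 2)); first by right; exists l; right; rewrite cl.
  apply: same; rewrite ?divr_gt0// => l' l'0.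
  apply: lt_le_trans (cmin _ (ms l') l'0).
  by rewrite gt_max dc andbT ltr_pdivrMr// ltr_pMr// ltr1n.
have [q [/andP[cq qd] qs qmax]] := last_point_le s cd.
apply: (transfer q); last first.
  by apply: before_eq => // [|l']; [exact: lt_le_trans cq|exact/qmax/ms].
by right; case/predU1P: qs => [->|/sm[l' ->]]; [exists l|exists l']; left.
Qed.

End Coverage.

(** * Total correctness with a time bound *)

Section TimeBound.
Implicit Types (c : cmd) (N : nat).

(** The cost if every loop makes N iterations. A conditional is charged for
    both branches, which keeps the bound a sum. *)
Fixpoint time_bound N c : nat :=
  match c with
  | CSkip => 1
  | CISet _ e => (icost e).+1
  | CRSet _ e => (rcost e).+1
  | CIPut _ i e => (icost i + icost e).+1
  | CRPut _ i e => (icost i + rcost e).+1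
  | CSeq c1 c2 => (time_bound N c1 + time_bound N c2).+1
  | CIf b c1 c2 => (bcost b + (time_bound N c1 + time_bound N c2)).+1
  | CWhile b c => (bcost b).+1 + N * (bcost b + time_bound N c).+1
  end%N.

Fixpoint loop_depth c : nat :=
  match c with
  | CSeq c1 c2 | CIf _ c1 c2 => maxn (loop_depth c1) (loop_depth c2)
  | CWhile _ c => (loop_depth c).+1
  | _ => 0
  end.

(** Each level of nesting contributes one factor N. *)
Lemma time_bound_poly N c : (0 < N)%N ->
  (time_bound N c <= time_bound 1 c * N ^ loop_depth c)%N.
Proof.
move=> N0; have le_exp d d' : (d <= d')%N -> (N ^ d <= N ^ d')%N.
  by move=> dd'; rewrite leq_pexp2l.
elim: c => [|v e|v e|a i e|a i e|c1 IH1 c2 IH2|b c1 IH1 c2 IH2|b c IH] /=;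
  rewrite ?muln1//.
- have := le_exp _ _ (leq_maxl (loop_depth c1) (loop_depth c2)).
  have := le_exp _ _ (leq_maxr (loop_depth c1) (loop_depth c2)).
  move: (maxn _ _) => d.
  move: (N ^ loop_depth c1)%N (N ^ loop_depth c2)%N IH1 IH2.
  by have := expn_gt0 N d; rewrite N0; move: (N ^ d)%N; nia.
- have := le_exp _ _ (leq_maxl (loop_depth c1) (loop_depth c2)).
  have := le_exp _ _ (leq_maxr (loop_depth c1) (loop_depth c2)).
  move: (maxn _ _) => d.
  move: (N ^ loop_depth c1)%N (N ^ loop_depth c2)%N IH1 IH2.
  by have := expn_gt0 N d; rewrite N0; move: (N ^ d)%N; nia.
- rewrite expnS; move: IH.
  by have := expn_gt0 N (loop_depth c); rewrite N0; move: (N ^ _)%N; nia.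
Qed.

End TimeBound.

Section WeakestPrecondition.
Variables (R : realType) (N : nat).
Implicit Types (s : state R) (Q : state R -> Prop) (c : cmd).

(** Since the time is bounded by the syntactic [time_bound], a correctness
    proof only has to show that no loop makes more than N iterations. *)
Definition wp c Q s := exists s' t,
  [/\ exec c s s' t, (t <= time_bound N c)%N & Q s'].

Lemma wp_iset v e Q s : Q (set_ivar s v (ieval s e)) -> wp (CISet v e) Q s.
Proof. by move=> q; do 2!eexists; split; [exact: ExecISet| |]. Qed.

Lemma wp_rset v e Q s : Q (set_rvar s v (reval s e)) -> wp (CRSet v e) Q s.
Proof. by move=> q; do 2!eexists; split; [exact: ExecRSet| |]. Qed.

Lemma wp_rput a i e Q s :
  Q (set_rarr s a (ieval s i) (reval s e)) -> wp (CRPut a i e) Q s.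
Proof. by move=> q; do 2!eexists; split; [exact: ExecRPut| |]. Qed.

Lemma wp_skip Q s : Q s -> wp CSkip Q s.
Proof. by move=> q; do 2!eexists; split; [exact: ExecSkip| |]. Qed.

Lemma wp_seq c1 c2 Q s : wp c1 (wp c2 Q) s -> wp (CSeq c1 c2) Q s.
Proof.
move=> [s1 [t1 [e1 l1 [s2 [t2 [e2 l2 q]]]]]].
exists s2, (t1 + t2).+1; split=> //; first exact: ExecSeq e1 e2.
by rewrite /= ltnS leq_add.
Qed.

Lemma wp_if b c1 c2 Q s : (beval s b -> wp c1 Q s) ->
  (~~ beval s b -> wp c2 Q s) -> wp (CIf b c1 c2) Q s.
Proof.
move=> h1 h2; have [bs|bs] := boolP (beval s b).
  have [s' [t [e l q]]] := h1 bs; exists s', (bcost b + t).+1.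
  split=> //=; first exact: ExecIfTrue.
  by rewrite ltnS leq_add2l (leq_trans l) ?leq_addr.
have [s' [t [e l q]]] := h2 bs; exists s', (bcost b + t).+1.
split=> //=; first exact: ExecIfFalse.
by rewrite ltnS leq_add2l (leq_trans l) ?leq_addl.
Qed.

Lemma wp_while (I : nat -> state R -> Prop) b c Q s :
  I 0%N s ->
  (forall i s', (i < N)%N -> I i s' -> beval s' b /\ wp c (I i.+1) s') ->
  (forall s', I N s' -> ~~ beval s' b /\ Q s') ->
  wp (CWhile b c) Q s.
Proof.
move=> I0 step stop.
suff loop m i s1 : (i + m)%N = N -> I i s1 -> exists s' t,
    [/\ exec (CWhile b c) s1 s' t,
      (t <= (bcost b).+1 + m * (bcost b + time_bound N c).+1)%N & Q s'].
  by have [s' [t [e l q]]] := loop N 0%N s (add0n N) I0; exists s', t.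
elim: m i s1 => [|m IH] i s1.
  rewrite addn0 => -> /stop[bs q]; exists s1, (bcost b).+1.
  by split; [exact: ExecWhileFalse|rewrite addn0|].
move=> im Ii; have iN : (i < N)%N by rewrite -im addnS ltnS leq_addr.
have [bs [s2 [t1 [e1 l1 I2]]]] := step _ _ iN Ii.
have [s3 [t2 [e2 l2 q]]] := IH i.+1 s2 (etrans (addSnnS i m) im) I2.
exists s3, (bcost b + t1 + t2).+1; split=> //.
  exact: ExecWhileTrue bs e1 e2.
by rewrite mulSn; lia.
Qed.

Lemma wp_mono c Q Q' s : (forall s', Q s' -> Q' s') -> wp c Q s -> wp c Q' s.
Proof. by move=> h [s' [t [e l q]]]; exists s', t; split=> //; exact: h. Qed.

End WeakestPrecondition.

(** * The program *)

(** Index scalars: 0 holds n, 1 the item k under test, 2 the item l that k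
    crosses, 3 the item j of an inner loop, 4 the critical item, 5 the index t
    of the rounding. Real scalars: 0 holds b, 1 the quantile, 2 delta, 3 to 5
    the sums of means, variances and profits over the items before k, 6 and 7
    the best value and the variance of its greedy point, 8 the fraction of the
    critical item, 9 the value of the current greedy point. *)

Definition RTwo := RAdd ROne ROne.
Definition BRLt x y := BNot (BRLe y x).
Definition BREq x y := BAnd (BRLe x y) (BRLe y x).
Definition BOr x y := BNot (BAnd (BNot x) (BNot y)).

Definition profit_e v := RGet 0 (IVar v).
Definition mean_e v := RGet 1 (IVar v).
Definition stdev_e v := RGet 2 (IVar v).
Definition variance_e v := RMul (stdev_e v) (stdev_e v).
Definition unit_mean_e v := RDiv (mean_e v) (profit_e v).
Definition unit_variance_e v := RDiv (variance_e v) (profit_e v).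
(** At delta = 0 the division by 0 gives 0, so the adjusted mean is the mean,
    as it should be. *)
Definition density_e v :=
  RDiv (profit_e v)
    (RAdd (mean_e v)
       (RMul (RDiv (RVar 1) (RMul RTwo (RSqrt (RVar 2)))) (variance_e v))).
Definition late_e v :=
  BAnd (BREq (RVar 2) RZero) (BNot (BREq (stdev_e v) RZero)).

(** A form of [precedesE] without conditional: either only w is late, or v is
    not the only late one and the other keys decide. *)
Definition precedes_e v w :=
  BOr (BAnd (BNot (late_e v)) (late_e w))
    (BAnd (BNot (BAnd (late_e v) (BNot (late_e w))))
      (BOr (BRLt (density_e w) (density_e v))
        (BAnd (BREq (density_e v) (density_e w))
          (BOr (BRLt (unit_variance_e w) (unit_variance_e v))
            (BAnd (BREq (unit_variance_e v) (unit_variance_e w))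
               (BILe (IVar v) (IVar w))))))).

Section Tests.
Context {R : realType}.

Lemma beval_lt (s : state R) x y : beval s (BRLt x y) = (reval s x < reval s y).
Proof. by rewrite /= ltNge. Qed.

Lemma array_ofE n (x : 'I_n -> R) (j : 'I_n) : array_of x j = x j.
Proof. by rewrite /array_of valK. Qed.

Lemma beval_precedes n (K : instance R n) (s : state R) v w (k l : 'I_n) :
  rarr s 0 = array_of (profit K) -> rarr s 1 = array_of (mean K) ->
  rarr s 2 = array_of (stdev K) -> rvar s 1 = quantile K ->
  ivar s v = k -> ivar s w = l ->
  beval s (precedes_e v w) = precedes K (rvar s 2) k l.
Proof.
move=> c_ a_ sg_ q_ v_ w_.
have dens u (i : 'I_n) : ivar s u = i -> reval s (density_e u) = density K (rvar s 2) i.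
  move=> ui; rewrite /= ui c_ a_ sg_ q_ !array_ofE /density adjusted_meanE expr2.
  by rewrite (_ : 1 + 1 = 2).
have uvar u (i : 'I_n) : ivar s u = i ->
    reval s (unit_variance_e u) = stdev K i ^+ 2 / profit K i.
  by move=> ui; rewrite /= ui c_ sg_ !array_ofE expr2.
have late u (i : 'I_n) : ivar s u = i ->
    beval s (late_e u) = (rvar s 2 == 0) && (stdev K i != 0).
  by move=> ui; rewrite /= ui sg_ !array_ofE -!eq_le.
rewrite precedesE /precedes_e.
move: (late_e v) (late_e w) (late v k v_) (late w l w_) => lv lw Lv Lw.
move: (density_e v) (density_e w) (dens v k v_) (dens w l w_) => dv dw Dv Dw.
move: (unit_variance_e v) (unit_variance_e w) (uvar v k v_) (uvar w l w_).
move=> rv rw Rv Rw; rewrite /=.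
rewrite Lv Lw Dv Dw Rv Rw v_ w_ -!eq_le -!ltNge.
case: (density K _ l < _); case: (density K _ k == _); case: (_ / _ < _);
  case: (_ / _ == _ / _); case: (k <= l)%N;
  by case: (rvar s 2 == 0); case: (stdev K k == 0); case: (stdev K l == 0).
Qed.

End Tests.

Definition for_loop v body :=
  CSeq (CISet v (INum 0))
    (CWhile (BNot (BILe (IVar 0) (IVar v)))
       (CSeq body (CISet v (IAdd (IVar v) (INum 1))))).

(** The loop adds all items that precede k, k itself included; starting from
    the opposite of the data of k leaves the items before k. *)
Definition prefix_sums : cmd :=
  CSeq (CRSet 3 (RSub RZero (mean_e 1)))
  (CSeq (CRSet 4 (RSub RZero (variance_e 1)))
  (CSeq (CRSet 5 (RSub RZero (profit_e 1)))
  (for_loop 3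
    (CIf (precedes_e 3 1)
       (CSeq (CRSet 3 (RAdd (RVar 3) (mean_e 3)))
       (CSeq (CRSet 4 (RAdd (RVar 4) (variance_e 3)))
             (CRSet 5 (RAdd (RVar 5) (profit_e 3)))))
       CSkip)))).

Definition critical_e :=
  BAnd (BRLt (RAdd (RVar 3) (RMul (RVar 1) (RSqrt (RVar 4)))) (RVar 0))
    (BRLe (RVar 0) (RAdd (RAdd (RVar 3) (mean_e 1))
        (RMul (RVar 1) (RSqrt (RAdd (RVar 4) (variance_e 1)))))).

Definition fraction_e :=
  let d := RSub (RVar 0) (RVar 3) in
  let q2 := RMul (RVar 1) (RVar 1) in
  let a2 := RMul (mean_e 1) (mean_e 1) in
  let B := RAdd (RMul (RMul RTwo (mean_e 1)) d) (RMul q2 (variance_e 1)) in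
  RDiv (RSub B (RSqrt (RSub (RMul B B)
      (RMul (RMul (RMul RTwo RTwo) a2) (RSub (RMul d d) (RMul q2 (RVar 4)))))))
    (RMul RTwo a2).

Definition evaluate : cmd :=
  CSeq prefix_sums
  (CIf critical_e
    (CSeq (CRSet 8 fraction_e)
    (CSeq (CRSet 9 (RAdd (RVar 5) (RMul (profit_e 1) (RVar 8))))
      (CIf (BRLe (RVar 6) (RVar 9))
        (CSeq (CRSet 6 (RVar 9))
              (CRSet 7 (RAdd (RVar 4) (RMul (variance_e 1) (RVar 8)))))
        CSkip)))
    CSkip).

(** The square of this expression is the crossing. *)
Definition crossing_root_e :=
  RDiv (RMul (RDiv (RVar 1) RTwo)
             (RSub (unit_variance_e 1) (unit_variance_e 2)))
       (RSub (unit_mean_e 2) (unit_mean_e 1)).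

(** The record starts at -1, below the value of every greedy point. *)
Definition search : cmd :=
  CSeq (CRSet 6 (RSub RZero ROne))
  (for_loop 1
    (CSeq (CRSet 2 ROne)
    (CSeq evaluate
    (for_loop 2
      (CSeq (CRSet 2 (RMul crossing_root_e crossing_root_e))
      (CSeq evaluate
      (CSeq (CRSet 2 (RDiv (RVar 2) RTwo))
        evaluate))))))).

(** Moves to the variance of the recorded greedy point, and recomputes the sums
    for the item that is critical there. *)
Definition locate : cmd :=
  CSeq (CRSet 2 (RVar 7))
  (CSeq (for_loop 1 (CSeq prefix_sums
           (CIf critical_e (CISet 4 (IVar 1)) CSkip)))
  (CSeq (CISet 1 (IVar 4))
  (CSeq prefix_sums
    (CRSet 8 fraction_e)))).

(** Real array 3 first receives the items that precede k, k included; if the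
    fraction is 1, this is the greedy point itself, and t is any item outside.
    Otherwise k is dropped again, and t is k. *)
Definition round_solution : cmd :=
  CSeq (for_loop 3
    (CIf (precedes_e 3 1) (CRPut 3 (IVar 3) ROne)
       (CSeq (CRPut 3 (IVar 3) RZero) (CISet 5 (IVar 3)))))
  (CSeq (CIf (BRLt (RVar 8) ROne)
      (CSeq (CRPut 3 (IVar 1) RZero) (CISet 5 (IVar 1)))
      (CRSet 5 (RAdd (RVar 5) (profit_e 1))))
  (CIf (BRLe (profit_e 5) (RVar 5)) CSkip
    (CSeq (for_loop 3 (CRPut 3 (IVar 3) RZero))
       (CRPut 3 (IVar 5) ROne)))).

Definition knapsack_program : cmd :=
  CSeq search (CSeq locate round_solution).

Lemma knapsack_program_depth : loop_depth knapsack_program = 3.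
Proof. by []. Qed.

(** * Verification of the program *)

Section Memory.
Variables (R : realType) (n : nat) (K : instance R n).

(** With scalars stored as lists, running an assignment amounts to computing
    [set_nth]. *)
Definition memory (ns : seq nat) (xs : seq R) (out : nat -> R) : state R :=
  State (nth 0%N ns) (nth 0 xs) (fun _ _ => 0%N)
    (nth (fun _ => 0)
       [:: array_of (profit K); array_of (mean K); array_of (stdev K); out]).

Lemma set_ivar_memory ns xs out v m :
  set_ivar (memory ns xs out) v m = memory (set_nth 0%N ns v m) xs out.
Proof.
rewrite /set_ivar /memory /=; congr State; apply/funext => i.
by rewrite /update nth_set_nth.
Qed.

Lemma set_rvar_memory ns xs out v r :
  set_rvar (memory ns xs out) v r = memory ns (set_nth 0 xs v r) out.
Proof.
rewrite /set_rvar /memory /=; congr State; apply/funext => i.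
by rewrite /update nth_set_nth.
Qed.

Lemma set_rarr_memory ns xs out i r :
  set_rarr (memory ns xs out) 3 i r = memory ns xs (update out i r).
Proof.
rewrite /set_rarr /memory /=; congr State; apply/funext => a.
by rewrite /update; case: a => [|[|[|[|[|a]]]]].
Qed.

(** The index v has the value i at the start of the i-th iteration, so the
    loop stops after n iterations. *)
Lemma wp_for v body (I : nat -> state R -> Prop) (Q : state R -> Prop) s :
  (forall i s', I i s' -> ivar s' 0 = n /\ ivar s' v = i) ->
  I 0%N (set_ivar s v 0) ->
  (forall i s', (i < n)%N -> I i s' ->
    wp n body (fun s2 => I i.+1 (set_ivar s2 v (ivar s2 v).+1)) s') ->
  (forall s', I n s' -> Q s') -> wp n (for_loop v body) Q s.
Proof.
move=> Iv I0 step stop; apply: wp_seq; apply: wp_iset.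
apply: (wp_while (I := I)) => // [i s' lti Ii|s' In].
  have [e0 ev] := Iv _ _ Ii.
  split; first by rewrite /= e0 ev -ltnNge.
  apply: wp_seq; apply: wp_mono (step _ _ lti Ii) => s2 I2.
  by apply: wp_iset; rewrite /= addn1.
have [e0 ev] := Iv _ _ In; split; last exact: stop.
by rewrite /= e0 ev leqnn.
Qed.

Definition store (k l j kc t : nat) (delta A V C best db th ob : R) out :=
  memory [:: n; k; l; j; kc; t]
    [:: capacity K; quantile K; delta; A; V; C; best; db; th; ob] out.

Lemma input_storeE :
  input_state K = store 0 0 0 0 0 0 0 0 0 0 0 0 0 (fun _ => 0).
Proof.
rewrite /input_state /store /memory; congr State; apply/funext.
- by do 7?case.
- by do 11?case.
- by do 5?case.
Qed.

(** The value of the sums of [prefix_sums] after i iterations. *)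
Definition partial_sum delta k (F : 'I_n -> R) i :=
  - F k + \sum_(j < n | (j < i)%N && precedes K delta j k) F j.

Lemma partial_sum0 delta k F : partial_sum delta k F 0 = - F k.
Proof. by rewrite /partial_sum big_pred0 ?addr0. Qed.

Lemma partial_sumS delta k F (i : 'I_n) : partial_sum delta k F i.+1
  = if precedes K delta i k then partial_sum delta k F i + F i
    else partial_sum delta k F i.
Proof.
rewrite /partial_sum; case: ifPn => ik.
  rewrite (bigD1 i) /= ?ltnSn// -addrA; congr (_ + _).
  rewrite addrC; congr (_ + _); apply: eq_bigl => j.
  rewrite ltnS [in RHS]ltn_neqAle val_eqE.
  by case: (_ <= _)%N; case: (precedes _ _ _ _); case: (_ != _).
congr (_ + _); apply: eq_bigl => j; rewrite ltnS leq_eqVlt.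
have [/val_inj->|] //= := eqVneq (j : nat) i.
by rewrite (negPf ik) !andbF.
Qed.

Lemma partial_sum_all delta k F :
  partial_sum delta k F n = \sum_(j | before K delta k j) F j.
Proof.
rewrite /partial_sum (bigD1 k) /= ?ltn_ord ?precedes_refl// addrA addNr add0r.
by apply: eq_bigl => j; rewrite ltn_ord /before /= comes_beforeE.
Qed.

End Memory.

Ltac run_step := first
  [ apply: wp_seq
  | apply: wp_iset; rewrite /store set_ivar_memory /=
  | apply: wp_rset; rewrite /store set_rvar_memory /=
  | apply: wp_rput; rewrite /store set_rarr_memory /=
  | apply: wp_skip ].

Section PrefixSums.
Variables (R : realType) (n : nat) (K : instance R n).

Lemma wp_prefix_sums (k : 'I_n) l j kc t delta A V C best db th ob out Q :
  Q (store K k l n kc t delta (mean_before K delta k) (variance_before K delta k)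
       (profit_before K delta k) best db th ob out) ->
  wp n prefix_sums Q (store K k l j kc t delta A V C best db th ob out).
Proof.
move=> q; do 6!run_step; rewrite !array_ofE !sub0r.
pose I i s := s = store K k l i kc t delta (partial_sum K delta k (mean K) i)
  (partial_sum K delta k (fun j => stdev K j ^+ 2) i)
  (partial_sum K delta k (profit K) i) best db th ob out.
apply: (wp_for (I := I)) => [i _ ->//| |i _ lti ->|s' ->].
- by rewrite /I set_ivar_memory /= !partial_sum0 expr2.
- pose io := Ordinal lti.
  apply: wp_if => h.
    have {h} : precedes K delta io k.
      by move: h; rewrite (@beval_precedes _ _ K _ 3 1 io k).
    move=> ik; do 5!run_step.
    rewrite /I set_ivar_memory /=.
    have -> : i = io :> nat by [].
    by rewrite !(partial_sumS _ _ _ _ io) ik !array_ofE -expr2.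
  have {h} ik : ~~ precedes K delta io k.
    by move: h; rewrite (@beval_precedes _ _ K _ 3 1 io k).
  run_step; rewrite /I /store set_ivar_memory /=.
  have -> : i = io :> nat by [].
  by rewrite !(partial_sumS _ _ _ _ io) (negPf ik).
- by rewrite !partial_sum_all.
Qed.

End PrefixSums.

Section Search.
Variables (R : realType) (n : nat) (K : instance R n).
Hypothesis HK : standing_assumptions K.

Lemma beval_critical (k : 'I_n) l j kc t delta C best db th ob out :
  beval (store K k l j kc t delta (mean_before K delta k)
    (variance_before K delta k) C best db th ob out) critical_e
  = critical K delta k.
Proof.
rewrite /critical_e.
transitivity (beval (store K k l j kc t delta (mean_before K delta k)
    (variance_before K delta k) C best db th ob out)
     (BRLt (RAdd (RVar 3) (RMul (RVar 1) (RSqrt (RVar 4)))) (RVar 0))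
   && beval (store K k l j kc t delta (mean_before K delta k)
    (variance_before K delta k) C best db th ob out)
     (BRLe (RVar 0) (RAdd (RAdd (RVar 3) (mean_e 1))
        (RMul (RVar 1) (RSqrt (RAdd (RVar 4) (variance_e 1))))))) => //.
by rewrite beval_lt /= !array_ofE -expr2.
Qed.

Lemma reval_fraction (k : 'I_n) l j kc t delta C best db th ob out :
  reval (store K k l j kc t delta (mean_before K delta k)
    (variance_before K delta k) C best db th ob out) fraction_e
  = greedy_fraction K delta k.
Proof.
rewrite /= !array_ofE /greedy_fraction /critical_fraction -!expr2.
have -> : (1 + 1) ^+ 2 = 4 :> R by ring.
by [].
Qed.

Lemma objective_greedy delta k : critical K delta k ->
  objective K (greedy_point K delta)
  = profit_before K delta k + profit K k * greedy_fraction K delta k.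
Proof. exact: sum_greedy_point. Qed.

Lemma variance_greedyE delta k : critical K delta k ->
  variance_of K (greedy_point K delta)
  = variance_before K delta k + stdev K k ^+ 2 * greedy_fraction K delta k.
Proof. exact: sum_greedy_point. Qed.

(** The alternative -1 is the state before any greedy point has been found. *)
Definition record_of_greedy (best db : R) := best = -1 \/
  exists delta, best = objective K (greedy_point K delta) /\
    db = variance_of K (greedy_point K delta).

Definition tested_at delta k v :=
  critical K delta k -> objective K (greedy_point K delta) <= v.

Lemma tested_le delta k v v' : v <= v' -> tested_at delta k v -> tested_at delta k v'.
Proof. by move=> vv' h /h /le_trans; apply. Qed.

Lemma wp_evaluate (k : 'I_n) l j kc t delta A V C best db th ob out Q :
  record_of_greedy best db ->
  (forall A V C best' db' th ob, best <= best' -> tested_at delta k best' ->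
     record_of_greedy best' db' ->
     Q (store K k l n kc t delta A V C best' db' th ob out)) ->
  wp n evaluate Q (store K k l j kc t delta A V C best db th ob out).
Proof.
move=> ok q; run_step; apply: wp_prefix_sums.
apply: wp_if; rewrite beval_critical => kc'; last first.
  by run_step; apply: q => // kc''; rewrite kc'' in kc'.
run_step; apply: wp_rset; rewrite reval_fraction /store set_rvar_memory /=.
do 2!run_step; rewrite array_ofE -(objective_greedy kc').
apply: wp_if => /= le.
  do 3!run_step; rewrite array_ofE -expr2 -(variance_greedyE kc').
  by apply: q => //; right; exists delta.
by run_step; apply: q => // _; rewrite ltW// ltNge.
Qed.

(** The outer loop tests the parameter 1 and the inner loop the crossings with
    l and their halves, so that [test_points_cover] applies at the end. *)
Lemma wp_search k l j kc t delta A V C best db th ob out Q :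
  (forall k l j delta A V C best db th ob, record_of_greedy best db ->
    (forall d, 0 <= d -> objective K (greedy_point K d) <= best) ->
    Q (store K k l j kc t delta A V C best db th ob out)) ->
  wp n search Q (store K k l j kc t delta A V C best db th ob out).
Proof.
move=> q; do 2!run_step; rewrite sub0r.
pose test_upto (i : nat) v := forall k' : 'I_n, (k' < i)%N ->
  forall d, test_point K k' d -> tested_at d k' v.
have test_upto_le i v v' : v <= v' -> test_upto i v -> test_upto i v'.
  by move=> vv' h k' ki d td; apply: tested_le vv' (h _ ki _ td).
pose I i s := exists l j delta A V C best db th ob,
  [/\ s = store K i l j kc t delta A V C best db th ob out, record_of_greedy best db &
    test_upto i best].
apply: (wp_for (I := I)) => [i _ [? [? [? [? [? [? [? [? [? [? [->]]]]]]]]]]]//| | |].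
- rewrite set_ivar_memory /=; do 10!eexists; split; first reflexivity.
    by left.
  by [].
- move=> i _ lti [l1 [j1 [d1 [A1 [V1 [C1 [best1 [db1 [th1 [ob1 [-> ok1 up1]]]]]]]]]]].
  have [ko koE] : exists ko : 'I_n, i = ko by exists (Ordinal lti).
  move: up1; rewrite {}koE => up1.
  do 3!run_step; apply: wp_evaluate => // A2 V2 C2 best2 db2 th2 ob2 le2 t2 ok2.
  have up2 := test_upto_le _ _ _ le2 up1.
  pose J (i : nat) s := exists j delta A V C best db th ob,
    [/\ s = store K ko i j kc t delta A V C best db th ob out, record_of_greedy best db,
        test_upto ko best, tested_at 1 ko best &
        forall l' : 'I_n, (l' < i)%N -> tested_at (crossing K ko l') ko best /\
          tested_at (crossing K ko l' / 2) ko best].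
  apply: (wp_for (I := J)) => [i' _ [? [? [? [? [? [? [? [? [? [->]]]]]]]]]]//| | |].
  + rewrite /store set_ivar_memory /=; do 9!eexists.
    by split; first reflexivity.
  + move=> i' _ lti' [j3 [d3 [A3 [V3 [C3 [best3 [db3 [th3 [ob3 [-> ok3 up3 t3 te3]]]]]]]]]].
    have [lo loE] : exists lo : 'I_n, i' = lo by exists (Ordinal lti').
    move: te3; rewrite {}loE => te3.
    do 2!run_step; rewrite !array_ofE -!expr2 (_ : 1 + 1 = 2)// -/(crossing K ko lo).
    run_step; apply: wp_evaluate => // A4 V4 C4 best4 db4 th4 ob4 le4 t4 ok4.
    do 2!run_step; rewrite (_ : 1 + 1 = 2)//.
    apply: wp_evaluate => // A5 V5 C5 best5 db5 th5 ob5 le5 t5 ok5.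
    rewrite /J /store set_ivar_memory /=; do 9!eexists; split; first reflexivity => //.
    * exact: ok5.
    * exact: test_upto_le le5 (test_upto_le _ _ _ le4 up3).
    * exact: tested_le le5 (tested_le le4 t3).
    * move=> l'; rewrite ltnS leq_eqVlt => /predU1P[/val_inj->|/te3[ta tb]].
        by split; [exact: tested_le le5 t4|exact: t5].
      by split; [exact: tested_le le5 (tested_le le4 ta)
                |exact: tested_le le5 (tested_le le4 tb)].
  + move=> _ [j3 [d3 [A3 [V3 [C3 [best3 [db3 [th3 [ob3 [-> ok3 up3 t3 te3]]]]]]]]]].
    rewrite /I /store set_ivar_memory /=; do 10!eexists; split; first reflexivity => //.
      exact: ok3.
    move=> k'; rewrite ltnS leq_eqVlt => /predU1P[/val_inj-> d|/up3//].
    by case=> [->//|[l' []->]]; case: (te3 l' (ltn_ord l')).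
- move=> _ [l1 [j1 [d1 [A1 [V1 [C1 [best1 [db1 [th1 [ob1 [-> ok1 up1]]]]]]]]]]].
  apply: q => //; apply: (test_points_cover HK) => k' d.
  exact: up1.
Qed.

End Search.

Section Output.
Variables (R : realType) (n : nat) (K : instance R n).
Hypothesis HK : standing_assumptions K.

Lemma wp_locate k l j kc t delta A V C best db th ob out Q :
  (forall (k : 'I_n) l C' th', critical K db k ->
     C' = profit_before K db k -> th' = greedy_fraction K db k ->
     Q (store K k l n k t db (mean_before K db k) (variance_before K db k)
          C' best db th' ob out)) ->
  wp n locate Q (store K k l j kc t delta A V C best db th ob out).
Proof.
move=> q; do 3!run_step.
pose I i s := exists j kc A V C,
  s = store K i l j kc t db A V C best db th ob out /\
  forall k' : 'I_n, (k' < i)%N -> critical K db k' -> kc = k'.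
apply: (wp_for (I := I)) => [i _ [? [? [? [? [? [->]]]]]]//| | |].
- by rewrite set_ivar_memory /=; do 5!eexists; split; first reflexivity.
- move=> i _ lti [j1 [kc1 [A1 [V1 [C1 [-> found]]]]]].
  have [ko koE] : exists ko : 'I_n, i = ko by exists (Ordinal lti).
  move: found; rewrite {}koE => found.
  run_step; apply: wp_prefix_sums; apply: wp_if; rewrite beval_critical => kc'.
    run_step; rewrite /I /store set_ivar_memory /=; do 5!eexists; split; first reflexivity.
    move=> k' _ k'c; congr nat_of_ord.
    exact: (critical_uniq HK kc' k'c).
  run_step; rewrite /I /store set_ivar_memory /=; do 5!eexists; split; first reflexivity.
  move=> k'; rewrite ltnS leq_eqVlt => /predU1P[/val_inj->|/found//].
  by rewrite (negPf kc').
- move=> _ [j1 [kc1 [A1 [V1 [C1 [-> found]]]]]].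
  have [k0 k0c] := exists_critical HK db.
  rewrite (found k0 (ltn_ord k0) k0c).
  do 3!run_step; apply: wp_prefix_sums; apply: wp_rset.
  by rewrite reval_fraction /store set_rvar_memory /=; exact: q.
Qed.

Lemma objective_unit_point t : objective K (unit_point R t) = profit K t.
Proof.
rewrite /objective (bigD1 t)//= /unit_point eqxx mulr1 big1 ?addr0//.
by move=> j /negPf->; rewrite mulr0.
Qed.

Let z delta := greedy_point K delta.

Lemma wp_choose k l j kc (t : 'I_n) delta A V C best db th ob (out : nat -> R) Q :
  (forall i : 'I_n, out i = round_down (z delta) i) ->
  C = objective K (round_down (z delta)) ->
  (forall s', (output s' : 'I_n -> R) = better_rounding K (z delta) t -> Q s') ->
  wp n (CIf (BRLe (profit_e 5) (RVar 5)) CSkip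
    (CSeq (for_loop 3 (CRPut 3 (IVar 3) RZero))
       (CRPut 3 (IVar 5) ROne))) Q
   (store K k l j kc t delta A V C best db th ob out).
Proof.
move=> outE CE q; apply: wp_if => /= le; rewrite array_ofE CE -objective_unit_point in le.
  run_step; apply: q; rewrite /better_rounding le; apply/funext => i.
  by rewrite /output /= outE.
run_step.
pose I i s := exists out', s = store K k l i kc t delta A V C best db th ob out' /\
  forall j : 'I_n, (j < i)%N -> out' j = 0.
apply: (wp_for (I := I)) => [i _ [? [->]]//| | |].
- by rewrite /store set_ivar_memory /=; eexists; split; first reflexivity.
- move=> i _ lti [out' [-> zero]].
  run_step; rewrite /I /store set_ivar_memory /=; eexists; split; first reflexivity.
  move=> i'; rewrite ltnS /update; case: eqP => // /eqP ii' le'.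
  by apply: zero; rewrite ltn_neqAle ii'.
- move=> _ [out' [-> zero]].
  run_step; apply: q; rewrite /better_rounding (negPf le); apply/funext => i.
  rewrite /output /= /update /unit_point -val_eqE; case: eqP => // _.
  exact: zero.
Qed.

(** If the fraction is 1 then some item lies outside the greedy point, because
    all items together exceed the capacity. *)
Lemma wp_round (k : 'I_n) l j kc t delta A V best db ob out Q :
  critical K delta k ->
  (forall (t : 'I_n) s', fractional_index (z delta) t ->
     (output s' : 'I_n -> R) = better_rounding K (z delta) t -> Q s') ->
  wp n round_solution Q
    (store K k l j kc t delta A V (profit_before K delta k) best db
      (greedy_fraction K delta k) ob out).
Proof.
move=> kc0 q.
have [th0 th1 _ _] := greedy_fractionP HK kc0.
have zE := greedy_pointE HK kc0.
have z01 := unit_box_greedy HK delta.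
have rdE i : round_down (z delta) i = (z delta i == 1)%:R by exact: round_downE.
run_step.
pose I i s := exists t out, [/\
  s = store K k l i kc t delta A V (profit_before K delta k) best db
      (greedy_fraction K delta k) ob out,
  forall j : 'I_n, (j < i)%N -> out j = (precedes K delta j k)%:R &
  (exists2 t0 : 'I_n, t = t0 & ~~ precedes K delta t0 k) \/
  forall j : 'I_n, (j < i)%N -> precedes K delta j k].
apply: (wp_for (I := I)) => [i _ [? [? [->]]]//| | |].
- rewrite /store set_ivar_memory /=; do 2!eexists; split; first reflexivity => //.
    by [].
  by right.
- move=> i _ lti [t1 [out1 [-> outE tE]]].
  have [io ioE] : exists io : 'I_n, i = io by exists (Ordinal lti).
  move: outE tE; rewrite {}ioE => outE tE.
  apply: wp_if; rewrite (@beval_precedes _ _ K _ 3 1 io k)//= => h.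
    run_step; rewrite /I /store set_ivar_memory /=; do 2!eexists; split; first reflexivity.
      move=> i'; rewrite ltnS leq_eqVlt => /predU1P[/val_inj->|lt].
        by rewrite /update eqxx h.
      by rewrite /update ltn_eqF// outE.
    case: tE => [tE|tE]; [by left|right] => i'.
    by rewrite ltnS leq_eqVlt => /predU1P[/val_inj->|/tE].
  do 3!run_step; rewrite /I /store set_ivar_memory /=; do 2!eexists; split; first reflexivity.
    move=> i'; rewrite ltnS leq_eqVlt => /predU1P[/val_inj->|lt].
      by rewrite /update eqxx (negPf h).
    by rewrite /update ltn_eqF// outE.
  by left; exists io.
- move=> _ [t1 [out1 [-> outE tE]]].
  have bE i : before K delta k i = precedes K delta i k && (i != k).
    exact: comes_beforeE.
  run_step; apply: wp_if; rewrite beval_lt /= => thlt.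
    have /lt_eqF thn1 : greedy_fraction K delta k < 1 := thlt.
    do 3!run_step.
    have frac : fractional_index (z delta) k.
      by left; rewrite /z zE bE eqxx andbF th0 thlt.
    have rd i : round_down (z delta) i = (before K delta k i)%:R.
      rewrite rdE /z zE; case: (before K delta k i); first by rewrite eqxx.
      by case: (i == k); rewrite ?thn1// eq_sym oner_eq0.
    apply: (@wp_choose _ _ _ _ k) => [i| |s' s'E].
    + rewrite rd bE /update val_eqE.
      by case: eqVneq => [_|_]; rewrite ?andbF// andbT outE.
    + rewrite /objective /profit_before big_mkcond; apply: eq_bigr => i _.
      by rewrite rd; case: (before K delta k i); rewrite ?mulr1 ?mulr0.
    + exact: q frac s'E.
  have {th0 th1 thlt} th1 : greedy_fraction K delta k = 1.
    by apply/eqP; rewrite eq_le th1 leNgt.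
  have zP i : z delta i = (precedes K delta i k)%:R.
    rewrite /z zE bE th1; case: eqVneq => [->|ik]; first by rewrite precedes_refl andbF.
    by rewrite andbT; case: ifP.
  have [t0 t1E t0N] : exists2 t0 : 'I_n, t1 = t0 & ~~ precedes K delta t0 k.
    case: tE => // all; exfalso.
    have := relaxed_load_greedy HK delta.
    have : capacity K < \sum_j mean K j
       + quantile K * Num.sqrt (\sum_j stdev K j ^+ 2) by case: HK.
    rewrite /relaxed_load; move=> /[swap]; rewrite -/(z delta).
    have one (F : 'I_n -> R) : \sum_j F j * z delta j = \sum_j F j.
      by apply: eq_bigr => i _; rewrite zP all ?mulr1.
    by rewrite !one => ->; rewrite ltxx.
  run_step; rewrite array_ofE t1E.
  apply: (@wp_choose _ _ _ _ t0) => [i| |s' s'E].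
  + by rewrite rdE zP outE//; case: precedes; rewrite ?eqxx// eq_sym oner_eq0.
  + transitivity (objective K (z delta)).
      by rewrite (objective_greedy HK kc0) th1 mulr1.
    apply: eq_bigr => i _; rewrite rdE zP.
    by case: precedes; rewrite ?eqxx// eq_sym oner_eq0.
  + apply: q s'E; right; split; last by rewrite zP (negPf t0N).
    by move=> i; rewrite zP; case: precedes; rewrite ?ltxx ?andbF.
Qed.

End Output.

Lemma wp_knapsack_program (R : realType) n (K : instance R n) :
  standing_assumptions K ->
  wp n knapsack_program (fun s => is_xA K (output s)) (input_state K).
Proof.
move=> HK; rewrite input_storeE; apply: wp_seq; apply: (wp_search HK).
move=> k l j delta A V C best db th ob ok cover.
have [d dmax dbE] : exists2 d, forall d', 0 <= d' ->
      objective K (greedy_point K d') <= objective K (greedy_point K d) &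
    db = variance_of K (greedy_point K d).
  case: ok => [b1|[d [bE dbE]]]; last first.
    by rewrite {}bE in cover; exists d; [exact: cover|exact: dbE].
  have z01 := unit_box_greedy HK 0.
  have : 0 <= objective K (greedy_point K 0).
    apply: sumr_ge0 => i _; case/andP: (z01 i) => z0 _.
    by case: HK => /(_ i)[c0 _ _] _ _ _ _; rewrite mulr_ge0// ltW.
  by move=> /le_trans/(_ (cover 0 (lexx 0))); rewrite b1; lra.
apply: wp_seq; apply: (wp_locate HK) => k' l' C' th' kc -> ->.
apply: (wp_round HK) => // t s tf ->.
have [gamma gP] := exists_below_reverse_points HK.
have [q qb qE] := exists_best_candidate HK gP dmax.
rewrite -dbE in qE; exists gamma, q, t; split; first exact: gP.
- exact: qb.
- exact: (eq_ind_r (fun y => fractional_index y t) tf qE).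
- exact: (esym (congr1 (fun y => better_rounding K y t) qE)).
Qed.

Lemma time_bound_cubic (R : realType) (c : cmd) : loop_depth c = 3 ->
  exists C : R, forall n, (1 < n)%N ->
  (time_bound n c)%:R <= C * (n%:R ^+ 3 * ln n%:R).
Proof.
move=> c3; have ln2 : 0 < ln 2 :> R by rewrite ln_gt0// ltr1n.
exists ((time_bound 1 c)%:R / ln 2) => n n1.
have n0 : (0 < n)%N by exact: ltnW.
have := time_bound_poly c n0; rewrite c3.
move: (time_bound 1 c) => w; rewrite -(ler_nat R) => /le_trans; apply.
rewrite natrM natrX -mulrA ler_wpM2l// mulrCA ler_peMr ?exprn_ge0//.
rewrite mulrC ler_pdivlMr// mul1r ler_ln ?posrE ?ltr0n//.
by rewrite ler_nat.
Qed.

(** A single item fits while all items together do not, so there are at least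
    two. *)
Lemma standing_assumptions_gt1 (R : realType) n (K : instance R n) :
  standing_assumptions K -> (1 < n)%N.
Proof.
move=> HK; case: n K HK => [|[|n]] K [pos b0 _ + le1] //.
  by rewrite !big_ord0 sqrtr0 mulr0 addr0 => /(lt_trans b0); rewrite ltxx.
have [_ _ sg] := pos ord0.
rewrite !big_ord1 sqrtr_sqr ger0_norm// => lt1.
by have := lt_le_trans lt1 (le1 ord0); rewrite ltxx.
Qed.

(** * The approximation theorem *)

Theorem theorem4 (R : realType) :
  (forall (n : nat) (K : instance R n), standing_assumptions K ->
     forall (d : measure_display) (T : measurableType d) (P : probability T R)
            (W : 'I_n -> {RV P >-> R}), random_weights K W ->
     forall x : 'I_n -> R, is_xA K x -> approximate_solution K W (1 / 2) x)
  /\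
  (exists (prog : cmd) (C : R),
     forall (n : nat) (K : instance R n), standing_assumptions K ->
     exists (s : state R) (t : nat),
       [/\ exec prog (input_state K) s t,
           t%:R <= C * (n%:R ^+ 3 * ln n%:R)
         & is_xA K (output s)]).
Proof.
split=> [n K HK d T P W WK x xA|].
  split; first by apply/(ckp_feasibleE _ HK WK); exact: better_rounding_feasible.
  rewrite /ckp_opt /max_of; case: xgetP => [_ _ [[y yf <-] _]|_].
    have [y01 yb] := (ckp_feasibleE y HK WK).1 yf.
    apply: better_rounding_half => // j.
    by case: (y01 j) => ->; rewrite ?lexx ?ler01.
  rewrite mulr0; apply: sumr_ge0 => j _.
  have [c0 _ _] : [/\ 0 < profit K j, 0 < mean K j & 0 <= stdev K j].
    by case: HK => /(_ j).
  have [x01 _] := better_rounding_feasible HK xA.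
  by case: (x01 j) => ->; rewrite ?mulr0// mulr1 ltW.
have [C CP] := time_bound_cubic R knapsack_program_depth.
exists knapsack_program, C => n K HK.
have [s [t [e tb xA]]] := wp_knapsack_program HK.
exists s, t; split=> //; apply: le_trans (CP _ (standing_assumptions_gt1 HK)).
by rewrite ler_nat.
Qed.
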